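(* Let $\lambda\in\mathcal M$ and $\mu$ be nonzero finite Borel measures on $S^{n-1}$ not concentrated on any closed hemisphere, and let $\Psi\in\mathscr G_I$. Then there exists $K\in\mathscr K^n_{(o)}$ with $\frac{\mu}{|\mu|}=\frac{\widetilde J_{\Psi,\lambda}(K,\cdot)}{\widetilde J_{\Psi,\lambda}(K,S^{n-1})}$. If in addition $\lambda$ is strictly positive on nonempty open subsets of $S^{n-1}$, then for a nonzero finite Borel measure $\mu$, being not concentrated on any closed hemisphere is also necessary for this equality to hold for some $K\in\mathscr K^n_{(o)}$.
   Context: $S^{n-1}$ unit sphere of $\mathbb R^n$, $n\ge2$, $d\xi$ spherical Lebesgue measure, $|\mu|=\mu(S^{n-1})$. $\mathscr K^n_{(o)}$: compact convex sets with the origin in their interior. For $K$: $h_K(x)=\max\{x\cdot y:y\in K\}$, $\rho_K(x)=\max\{t\ge0:tx\in K\}$; $\pmb\alpha_K(\xi)$ set of outer unit normals at $\rho_K(\xi)\xi$, singleton $\{\alpha_K(\xi)\}$ a.e.; $\pmb\alpha^*_K(\omega)=\{\xi:\pmb\alpha_K(\xi)\cap\omega\ne\emptyset\}$. $\mathscr G_I$: functions $\Psi:S^{n-1}\times(0,\infty)\to(0,\infty)$ with $\Psi$, $\Psi_t=\partial\Psi/\partial t$ continuous and, for each $u$, $\Psi_t(u,\cdot)>0$, $\lim_{t\to0^+}\Psi(u,t)=0$, $\lim_{t\to\infty}\Psi(u,t)=\infty$. $\mathcal M$: nonzero finite Borel measures absolutely continuous w.r.t. $d\xi$. $\widetilde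 J_{\Psi,\lambda}(K,\omega)=\int_{\pmb\alpha^*_K(\omega)}\frac{d\lambda(\xi)}{h_K(\alpha_K(\xi))\Psi_t(\alpha_K(\xi),h_K(\alpha_K(\xi)))}$. Not concentrated on any closed hemisphere: $\int(u\cdot\xi)_+d\mu(\xi)>0$ for all $u$. *)

(* Defs.v *)
From HB Require Import structures.
From mathcomp Require Import all_boot all_order all_algebra.
From mathcomp Require Import all_classical all_reals all_analysis.
Set Implicit Arguments. Unset Strict Implicit. Unset Printing Implicit Defensive.
Import Order.TTheory GRing.Theory Num.Theory.
Import numFieldNormedType.Exports.
Local Open Scope classical_set_scope.
Local Open Scope ring_scope.

Notation borelV R n := (g_sigma_algebraType (@open 'rV[R]_n)).

Section Defs.
Variables (R : realType) (n : nat).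
Local Notation V := 'rV[R]_n.

Definition dotp (x y : V) : R := \sum_(i < n) x ord0 i * y ord0 i.
Definition sphere : set V := [set x | dotp x x = 1].

(** Borel sigma-algebra on R^n (generated by the open sets).
    Borel measures on S^{n-1} are represented as Borel measures on R^n
    vanishing outside S^{n-1}. *)

Definition box (a b : V) : set V := [set x | forall i, a ord0 i <= x ord0 i <= b ord0 i].
Definition boxvol (a b : V) : R := \prod_(i < n) (b ord0 i - a ord0 i).
Definition leb_null (A : set V) : Prop :=
  forall eps : R, 0 < eps -> exists a b : nat -> V,
    (forall k i, a k ord0 i <= b k ord0 i) /\
    A `<=` \bigcup_k box (a k) (b k) /\
    (forall N, \sum_(k < N) boxvol (a k) (b k) <= eps).

(** Null sets of the spherical Lebesgue measure d xi: a set A of the sphere is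
    d xi-null iff its cone {t x : 0 < t <= 1, x in A} is Lebesgue null
    (since d xi(A) = n * Leb({t x : 0 < t <= 1, x in A})). *)
Definition cone (A : set V) : set V := [set y | exists t x, 0 < t <= 1 /\ A x /\ y = t *: x].
Definition sph_null (A : set V) : Prop := leb_null (cone (A `&` sphere)).

Definition finite_sph_measure (mu : {measure set (borelV R n) -> \bar R}) : Prop :=
  (mu setT < +oo)%E /\ mu setT <> 0%E /\ mu (~` sphere) = 0%E.

Definition in_M (lam : {measure set (borelV R n) -> \bar R}) : Prop :=
  finite_sph_measure lam /\
  (forall A : set (borelV R n), measurable A -> sph_null A -> lam A = 0%E).

Definition not_concentrated (mu : {measure set (borelV R n) -> \bar R}) : Prop :=
  forall u : V, sphere u ->
    (0 < \int[mu]_(x in (sphere : set (borelV R n))) (Num.max (dotp u x) 0)%:E)%E.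

Definition pos_on_open (lam : {measure set (borelV R n) -> \bar R}) : Prop :=
  forall O : set V, open O -> (O `&` sphere) !=set0 ->
    (0 < lam (O `&` sphere))%E.

Definition convex_set (K : set V) : Prop :=
  forall x y (t : R), K x -> K y -> 0 <= t <= 1 -> K (t *: x + (1 - t) *: y).
Definition convex_body_o (K : set V) : Prop :=
  compact K /\ convex_set K /\ interior K 0.

Definition supp_fun (K : set V) (x : V) : R := sup [set dotp x y | y in K].
Definition radial_fun (K : set V) (x : V) : R := sup [set t | 0 <= t /\ K (t *: x)].

Definition normals (K : set V) (xi : V) : set V :=
  [set u | sphere u /\ dotp u (radial_fun K xi *: xi) = supp_fun K u].
(** alpha_K(xi): a chosen element of pmb alpha_K(xi) (it is the unique
    element for almost every xi) *)
Definition alpha (K : set V) (xi : V) : V := xget 0 (normals K xi).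
Definition alpha_star (K : set V) (omega : set V) : set V :=
  [set xi | sphere xi /\ exists2 u, normals K xi u & omega u].

Definition Psi_t (Psi : V -> R -> R) (u : V) (t : R) : R := derive1 (Psi u) t.

Definition G_I (Psi : V -> R -> R) : Prop :=
  (forall u t, sphere u -> 0 < t -> 0 < Psi u t) /\
  (forall u t, sphere u -> 0 < t -> derivable (Psi u) t 1) /\
  {within [set p : V * R | sphere p.1 /\ 0 < p.2], continuous (fun p => Psi p.1 p.2)} /\
  {within [set p : V * R | sphere p.1 /\ 0 < p.2], continuous (fun p => Psi_t Psi p.1 p.2)} /\
  (forall u t, sphere u -> 0 < t -> 0 < Psi_t Psi u t) /\
  (forall u, sphere u -> Psi u t @[t --> 0^'+] --> 0) /\
  (forall u, sphere u -> Psi u t @[t --> +oo] --> +oo).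

Definition Jtilde (Psi : V -> R -> R) (lam : {measure set (borelV R n) -> \bar R})
    (K : set V) (omega : set V) : \bar R :=
  \int[lam]_(xi in (alpha_star K omega : set (borelV R n)))
     ((supp_fun K (alpha K xi) * Psi_t Psi (alpha K xi) (supp_fun K (alpha K xi)))^-1)%:E.

(** mu / |mu| = J(.) / J(S^{n-1}) on Borel subsets of S^{n-1}
    (J(S^{n-1}) is required to be finite and positive so that the
    right-hand side makes sense) *)
Definition normalized_eq (mu : {measure set (borelV R n) -> \bar R}) (J : set V -> \bar R) : Prop :=
  (0 < J sphere)%E /\ (J sphere < +oo)%E /\
  forall omega : set (borelV R n), measurable omega -> omega `<=` sphere ->
    fine (mu omega) / fine (mu sphere) = fine (J omega) / fine (J sphere).

End Defs.

(* Main.v *)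
Require Import Defs.
From HB Require Import structures.
From mathcomp Require Import all_boot all_order all_algebra.
From mathcomp Require Import all_classical all_reals all_analysis.
From mathcomp Require Import measurable_realfun ring lra.
Set Implicit Arguments. Unset Strict Implicit. Unset Printing Implicit Defensive.
Import Order.TTheory GRing.Theory Num.Theory.
Import numFieldNormedType.Exports.
Local Open Scope classical_set_scope.
Local Open Scope ring_scope.

(** For f > 0 continuous on the sphere put polar f x = max_u (x . u) / f u.
    The Wulff shape K of f has gauge g = polar f (so the radial function is
    1 / g on the sphere) and support function h = polar g <= f.

    Existence is variational: minimize the integral of log (polar f) against
    lam under the constraint that the mu-integral of Psi(u, f u) is at most
    that of Psi(u, 1).  As neither measure is concentrated on a hemisphere,
    all support functions that satisfy the constraint and do as well as the
    unit ball lie in one class of uniformly Lipschitz functions bounded away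
    from 0; it is compact for pointwise convergence and the functional is
    continuous on it.  For a minimizer h, perturb to h / (1 + t phi): the
    difference quotients of the gauge converge to phi(alpha_K) wherever the
    normal is unique, so the sign of the mu-integral of Psi_t h phi controls
    that of the lam-integral of phi(alpha_K), and this is the Lagrange
    condition "J(K, .) is proportional to mu" tested on continuous functions.

    Uniqueness of normals a.e.: two normals at x give two subgradients of the
    convex function g at x, hence a jump of a partial derivative of g.

    Necessity: if mu vanishes on an open hemisphere centred at v, so does
    J(K, .), but all directions close to v have their normals in it. *)

(** * Euclidean preliminaries *)

(** The equation for $K$ is an Euler-Lagrange equation: minus the entropy is the $\lambda$-integral
    of $\log\rho_K$, and the level of the constraint only fixes the scale, since the multiplier
    cancels in the normalized equality. A perturbed support function is in general not a support
    function. For this reason the problem is posed for all positive continuous [f]: the entropy sees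
    only [polar f], and the double polar lowers [f] on the sphere, which preserves the constraint
    because $\Psi$ increases in $t$. The constraint is an inequality, so only perturbations that
    strictly lower it to first order are admissible, with [t > 0]. The outcome is one implication
    between signs of two linear functionals; applied to a function minus its mean plus a small
    constant, and to the negative of the function, it forces proportionality. A further obstacle is
    measurability: the set $\pmb\alpha^*_K(\omega)$ is not known to be Borel and [alpha] is an
    arbitrary choice at points with several normals. Integrals over it are therefore handled as
    suprema over simple functions and moved off a Borel null set, outside which a Borel Gauss map
    takes over. *)

Section Euclid.
Variables (R : realType) (n : nat).
Local Notation V := 'rV[R]_n.
Implicit Types (x y z u v : V) (t : R).

Lemma dotpC x y : dotp x y = dotp y x.
Proof. by apply: eq_bigr => i _; rewrite mulrC. Qed.

Lemma dotpDl x y z : dotp (x + y) z = dotp x z + dotp y z.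
Proof. by rewrite -big_split; apply: eq_bigr => i _; rewrite mxE mulrDl. Qed.

Lemma dotpZl t x y : dotp (t *: x) y = t * dotp x y.
Proof. by rewrite /dotp mulr_sumr; apply: eq_bigr => i _; rewrite mxE mulrA. Qed.

Lemma dotpDr x y z : dotp z (x + y) = dotp z x + dotp z y.
Proof. by rewrite dotpC dotpDl !(dotpC _ z). Qed.

Lemma dotpZr t x y : dotp x (t *: y) = t * dotp x y.
Proof. by rewrite dotpC dotpZl dotpC. Qed.

Lemma dotpNl x y : dotp (- x) y = - dotp x y.
Proof. by rewrite -scaleN1r dotpZl mulN1r. Qed.

Lemma dotpNr x y : dotp x (- y) = - dotp x y.
Proof. by rewrite dotpC dotpNl dotpC. Qed.

Lemma dotpBl x y z : dotp (x - y) z = dotp x z - dotp y z.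
Proof. by rewrite dotpDl dotpNl. Qed.

Lemma dotpBr x y z : dotp z (x - y) = dotp z x - dotp z y.
Proof. by rewrite dotpDr dotpNr. Qed.

Lemma dotp0l x : dotp 0 x = 0.
Proof. by rewrite /dotp big1// => i _; rewrite mxE mul0r. Qed.

Lemma dotp0r x : dotp x 0 = 0.
Proof. by rewrite dotpC dotp0l. Qed.

Lemma dotp_ge0 x : 0 <= dotp x x.
Proof. by apply: sumr_ge0 => i _; rewrite -expr2 sqr_ge0. Qed.

Lemma dotp_eq0 x : dotp x x = 0 -> x = 0.
Proof.
move/eqP; rewrite psumr_eq0 => [/allP h|i _]; last by rewrite -expr2 sqr_ge0.
apply/rowP => i; have /implyP/(_ isT) := h i (mem_index_enum _).
by rewrite mulf_eq0 orbb => /eqP ->; rewrite mxE.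
Qed.

Lemma coord_norm_le x i : `|x ord0 i| <= `|x|.
Proof. by rewrite [leRHS]mx_normrE; apply: (le_bigmax _ _ (ord0, i)). Qed.

Lemma norm_le_coord x t : 0 <= t -> (forall i, `|x ord0 i| <= t) -> `|x| <= t.
Proof.
move=> t0 h; rewrite [leLHS]mx_normrE; apply/bigmax_leP; split => // -[i j] _ /=.
by rewrite ord1.
Qed.

(** The norm of row vectors is the maximum norm, hence the factor [n], which recurs in every
    Lipschitz constant and radius below. *)
Lemma dotp_le_norm x y : `|dotp x y| <= n%:R * `|x| * `|y|.
Proof.
apply: le_trans (ler_norm_sum _ _ _) _.
apply: (@le_trans _ _ (\sum_(i < n) `|x| * `|y|)); last first.
  by rewrite sumr_const card_ord -mulrA mulr_natl.
apply: ler_sum => i _; rewrite normrM.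
by apply: ler_pM => //; exact: coord_norm_le.
Qed.

Lemma cvg_dotp (T : Type) (F : set_system T) {FF : Filter F} (f g : T -> V) x y :
  f @ F --> x -> g @ F --> y -> dotp (f z) (g z) @[z --> F] --> dotp x y.
Proof.
move=> fx gy; rewrite /dotp.
have h : forall (I : seq 'I_n), \sum_(i <- I) f z ord0 i * g z ord0 i @[z --> F]
    --> \sum_(i <- I) x ord0 i * y ord0 i.
  elim=> [|i s IH].
    rewrite big_nil; under eq_fun do rewrite big_nil; exact: cvg_cst.
  rewrite big_cons; under eq_fun do rewrite big_cons.
  apply: cvgD => //; apply: cvgM.
    exact: (cvg_comp _ _ fx (@coord_continuous R 1 n ord0 i x)).
  exact: (cvg_comp _ _ gy (@coord_continuous R 1 n ord0 i y)).
exact: h.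
Qed.

Lemma continuous_dotp y : continuous (fun x : V => dotp x y).
Proof. by move=> x; apply: (@cvg_dotp _ (nbhs x) _ id (fun=> y)) => //; exact: (@cvg_cst _ _ _ (nbhs x)). Qed.

Lemma sphere_norm_le u : sphere u -> `|u| <= 1.
Proof.
move=> su; apply: norm_le_coord => // i.
have : u ord0 i ^+ 2 <= 1.
  rewrite -su /dotp (bigD1 i)//= expr2 lerDl; apply: sumr_ge0 => j _.
  by rewrite -expr2 sqr_ge0.
by move=> h; rewrite -(ler_pXn2r (n := 2)) ?nnegrE ?ler01 ?normr_ge0// real_normK ?num_real// expr1n.
Qed.

Lemma dotp_sphere_le1 u v : sphere u -> sphere v -> dotp u v <= 1.
Proof.
rewrite /sphere /= => su sv; have := dotp_ge0 (u - v).
by rewrite dotpBl !dotpBr su sv (dotpC v u); lra.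
Qed.

Lemma sphere_opp u : sphere u -> sphere (- u).
Proof. by rewrite /sphere /= dotpNl dotpNr opprK. Qed.

Lemma sphere_dotp_norm u x : sphere u -> `|dotp x u| <= n%:R * `|x|.
Proof.
move=> su; apply: le_trans (dotp_le_norm _ _) _.
by rewrite ler_piMr ?sphere_norm_le// mulr_ge0.
Qed.

Lemma closed_sphere : closed (@sphere R n).
Proof.
rewrite (_ : @sphere R n = (fun x => dotp x x) @^-1` [set 1]) //.
apply: closed_comp => [x _|]; last exact: closed_eq.
by apply: (@cvg_dotp _ (nbhs x) _ id id); exact: cvg_id.
Qed.

Lemma compact_sphere : compact (@sphere R n).
Proof.
apply: bounded_closed_compact closed_sphere.
exists 1; split => // M M1 u su; exact: le_trans (sphere_norm_le su) (ltW M1).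
Qed.

Lemma delta_sphere (i : 'I_n) : sphere (delta_mx ord0 i : V).
Proof.
rewrite /sphere /= /dotp (bigD1 i)//= big1 ?addr0 => [|j /negbTE ji].
  by rewrite mxE !eqxx mulr1.
by rewrite mxE ji andbF mul0r.
Qed.

Lemma dotp_delta x i : dotp (delta_mx ord0 i) x = x ord0 i.
Proof.
rewrite /dotp (bigD1 i)//= big1 ?addr0 => [|j /negbTE ji].
  by rewrite mxE !eqxx mul1r.
by rewrite mxE ji andbF mul0r.
Qed.

Lemma lipschitz_continuous (f : V -> R) (L : R) :
  (forall x y, `|f x - f y| <= L * `|x - y|) -> continuous f.
Proof.
move=> Lf x A /nbhs_ballP[e /= e0 eA].
have d0 : 0 < e / (`|L| + 1) by rewrite divr_gt0// ltr_wpDl.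
apply/nbhs_ballP; exists (e / (`|L| + 1)) => //= y.
rewrite -ball_normE /= => xy; apply: eA.
rewrite /ball /=; apply: le_lt_trans (Lf _ _) _.
move: xy; rewrite ltr_pdivlMr ?ltr_wpDl// => h.
apply: le_lt_trans h; rewrite mulrC ler_wpM2l//.
by apply: le_trans (ler_norm _) _; rewrite lerDl.
Qed.

End Euclid.

(** * Polar functions *)

Section Polar.
Variables (R : realType) (n : nat).
Local Notation V := 'rV[R]_n.
Local Notation S := (@sphere R n).
Implicit Types (x y z u v : V) (t : R) (f g h : V -> R).

Definition csph f := {within S, continuous f}.
Definition cpos f := csph f /\ forall u, S u -> 0 < f u.
Definition polar f x := sup [set dotp x u / f u | u in S].

Lemma csph_max f : (0 < n)%N -> csph f ->
  exists2 u, S u & forall v, S v -> f v <= f u.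
Proof.
move=> n0 cf.
have S0 : S !=set0 by exists (delta_mx ord0 (Ordinal n0)); exact: delta_sphere.
have [u /set_mem Su h] := compact_EVT_max S0 (@compact_sphere R n) cf.
by exists u => // v Sv; apply: h; exact/mem_set.
Qed.

Lemma csphN f : csph f -> csph (fun x => - f x).
Proof. by move=> cf x; apply: continuousN; exact: cf. Qed.

Lemma csphM f g : csph f -> csph g -> csph (fun x => f x * g x).
Proof. by move=> cf cg x; apply: continuousM; [exact: cf|exact: cg]. Qed.

Lemma csphD f g : csph f -> csph g -> csph (fun x => f x + g x).
Proof. by move=> cf cg x; apply: continuousD; [exact: cf|exact: cg]. Qed.

Lemma csph_cst t : csph (fun=> t).
Proof. by move=> x; exact: cvg_cst. Qed.

Lemma csphV f : cpos f -> csph (fun x => (f x)^-1).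
Proof.
move=> [cf f0]; rewrite /csph continuous_subspace_in => x /set_mem Sx.
by apply: continuousV; [rewrite gt_eqF// f0|exact: cf].
Qed.

Lemma continuous_csph f : continuous f -> csph f.
Proof. exact: continuous_subspaceT. Qed.

Lemma csph_eq f g : (forall u, S u -> f u = g u) -> csph f -> csph g.
Proof. by move=> fg; apply: subspace_eq_continuous => u /set_mem; exact: fg. Qed.

Lemma cpos_min f : (0 < n)%N -> cpos f ->
  exists2 a, 0 < a & forall u, S u -> a <= f u.
Proof.
move=> n0 [cf f0]; have [u Su hu] := csph_max n0 (csphN cf).
by exists (f u); [exact: f0|move=> v /hu; rewrite lerN2].
Qed.

Lemma csph_bound f : (0 < n)%N -> csph f ->
  exists2 b, 0 < b & forall u, S u -> `|f u| <= b.
Proof.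
move=> n0 cf; have [u Su hu] := csph_max n0 cf.
have [v Sv hv] := csph_max n0 (csphN cf).
exists (`|f u| + `|f v| + 1) => [|w Sw]; first by rewrite ltr_wpDl// addr_ge0.
have := hu _ Sw; have := hv _ Sw; have := ler_norm (f u).
have := ler_norm (- f v); rewrite normrN ler_norml.
have := normr_ge0 (f u); have := normr_ge0 (f v).
by move=> *; apply/andP; split; lra.
Qed.

Lemma cpos_polar_max f x : (0 < n)%N -> cpos f ->
  exists2 u, S u & polar f x = dotp x u / f u /\
    forall v, S v -> dotp x v / f v <= polar f x.
Proof.
move=> n0 cf.
have [|u Su hu] := @csph_max (fun u => dotp x u / f u) n0.
  apply: csphM; last exact: csphV.
  apply: (@csph_eq (fun u => dotp u x)) => [u _|]; first exact: dotpC.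
  exact/continuous_csph/continuous_dotp.
have ub : ubound [set dotp x u / f u | u in S] (dotp x u / f u).
  by move=> _ [v Sv <-]; exact: hu.
have E : polar f x = dotp x u / f u.
  apply/eqP; rewrite eq_le; apply/andP; split.
    by apply: ge_sup => //; exists (dotp x u / f u), u.
  by apply: ub_le_sup; [exists (dotp x u / f u)|exists u].
by exists u => //; split => // v Sv; rewrite E; exact: hu.
Qed.

Lemma polar_ge f x u : (0 < n)%N -> cpos f -> S u -> dotp x u <= polar f x * f u.
Proof.
move=> n0 cf Su; have [v _ [_ /(_ u Su)]] := cpos_polar_max x n0 cf.
by rewrite ler_pdivrMr// cf.2.
Qed.

Lemma polar_att f x : (0 < n)%N -> cpos f ->
  exists2 u, S u & dotp x u = polar f x * f u.
Proof.
move=> n0 cf; have [v Sv [-> _]] := cpos_polar_max x n0 cf; exists v => //.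
by rewrite divfK// gt_eqF// cf.2.
Qed.

Lemma polar_le f x t : (0 < n)%N -> cpos f ->
  (forall u, S u -> dotp x u <= t * f u) -> polar f x <= t.
Proof.
move=> n0 cf h; have [v Sv [-> _]] := cpos_polar_max x n0 cf.
by rewrite ler_pdivrMr ?cf.2// h.
Qed.

(** A negative value would make both [dotp x u] and [dotp x (- u)] negative. *)
Lemma polar_ge0 f x : (0 < n)%N -> cpos f -> 0 <= polar f x.
Proof.
move=> n0 cf; pose u : V := delta_mx ord0 (Ordinal n0).
have Su : S u := delta_sphere _ _.
have := polar_ge x n0 cf Su; have := polar_ge x n0 cf (sphere_opp Su).
rewrite dotpNr; case: (leP 0 (polar f x)) => // p0.
have := cf.2 _ Su; have := cf.2 _ (sphere_opp Su) => f0 f1.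
have := nmulr_rlt0 (f u) p0; have := nmulr_rlt0 (f (- u)) p0.
by rewrite f0 f1; lra.
Qed.

Lemma polar_gt0 f x : (0 < n)%N -> cpos f -> S x -> 0 < polar f x.
Proof.
move=> n0 cf Sx; have := polar_ge x n0 cf Sx; rewrite Sx => h.
have := cf.2 _ Sx; have := polar_ge0 x n0 cf; rewrite le_eqVlt => /orP[/eqP E|//].
by move: h; rewrite -E mul0r ler10.
Qed.

Lemma polar0 f : (0 < n)%N -> cpos f -> polar f 0 = 0.
Proof.
move=> n0 cf; apply/eqP; rewrite eq_le polar_ge0// andbT.
by apply: polar_le => // u Su; rewrite dotp0l mul0r.
Qed.

Lemma polarZ f t x : (0 < n)%N -> cpos f -> 0 <= t -> polar f (t *: x) = t * polar f x.
Proof.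
move=> n0 cf t0; apply/eqP; rewrite eq_le; apply/andP; split.
  apply: polar_le => // u Su; rewrite dotpZl -mulrA ler_wpM2l//; exact: polar_ge.
have [u Su E] := polar_att x n0 cf.
have := polar_ge (t *: x) n0 cf Su; rewrite dotpZl E mulrA ler_pM2r//.
exact: cf.2.
Qed.

Lemma polarD f x y : (0 < n)%N -> cpos f -> polar f (x + y) <= polar f x + polar f y.
Proof.
move=> n0 cf; apply: polar_le => // u Su.
by rewrite dotpDl mulrDl lerD// polar_ge.
Qed.

Lemma polar_lip f a x y : (0 < n)%N -> cpos f -> 0 < a ->
  (forall u, S u -> a <= f u) -> `|polar f x - polar f y| <= n%:R / a * `|x - y|.
Proof.
move=> n0 cf a0 af.
have key z : polar f z <= n%:R / a * `|z|.
  apply: polar_le => // u Su; apply: (@le_trans _ _ (n%:R * `|z|)).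
    by apply: le_trans (ler_norm _) _; exact: sphere_dotp_norm.
  rewrite (_ : _ * f u = (n%:R * `|z|) * (f u / a)); last by ring.
  by rewrite ler_peMr ?mulr_ge0// ler_pdivlMr// mul1r af.
rewrite ler_norml; apply/andP; split.
  have := polarD (y - x) x n0 cf; rewrite subrK => h.
  have := key (y - x); rewrite -normrN opprB => k; lra.
have := polarD (x - y) y n0 cf; rewrite subrK => h.
have := key (x - y) => k; lra.
Qed.

Lemma polar_continuous f : (0 < n)%N -> cpos f -> continuous (polar f).
Proof.
move=> n0 cf; have [a a0 af] := cpos_min n0 cf.
by apply: (@lipschitz_continuous _ _ _ (n%:R / a)) => x y; exact: polar_lip.
Qed.

Lemma polar_cpos f : (0 < n)%N -> cpos f -> cpos (polar f).
Proof.
move=> n0 cf; split; first exact/continuous_csph/polar_continuous.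
by move=> u Su; exact: polar_gt0.
Qed.

Lemma polar_mono f g t x : (0 < n)%N -> cpos f -> cpos g ->
  (forall u, S u -> f u <= t * g u) -> polar g x <= t * polar f x.
Proof.
move=> n0 cf cg h; apply: polar_le => // u Su.
apply: le_trans (polar_ge x n0 cf Su) _.
by rewrite -mulrA mulrCA ler_wpM2l ?h// polar_ge0.
Qed.

Lemma polar_polar_le f u : (0 < n)%N -> cpos f -> S u -> polar (polar f) u <= f u.
Proof.
move=> n0 cf Su; apply: polar_le => // [|v Sv]; first exact: polar_cpos.
by rewrite dotpC mulrC; exact: polar_ge.
Qed.

(** The usual Galois argument for an order-reversing operation. It turns any [f] into a dual pair
    [polar (polar f)], [polar f] without changing the gauge. *)
Lemma polar3 f x : (0 < n)%N -> cpos f -> polar (polar (polar f)) x = polar f x.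
Proof.
move=> n0 cf; have c1 := polar_cpos n0 cf; have c2 := polar_cpos n0 c1.
apply/eqP; rewrite eq_le; apply/andP; split.
  apply: polar_le => // u Su; rewrite dotpC.
  have [v Sv E] := polar_att x n0 cf.
  have [->|x0] := eqVneq x 0; first by rewrite dotp0r polar0// mul0r.
  have d0 : 0 < dotp x x.
    rewrite lt_neqAle dotp_ge0 andbT eq_sym; apply: contra x0 => /eqP /dotp_eq0 ->.
    by rewrite eqxx.
  (* [polar_ge] tests unit vectors only, so [x] is divided by its Euclidean length and homogeneity
     restores it. *)
  pose s := Num.sqrt (dotp x x); have s0 : 0 < s by rewrite sqrtr_gt0.
  have ss : s * s = dotp x x by rewrite -expr2 sqr_sqrtr// dotp_ge0.
  have Sx : S (s^-1 *: x).
    by rewrite /sphere /= dotpZl dotpZr -ss; field; rewrite gt_eqF.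
  have := polar_ge u n0 c1 Sx; rewrite dotpZr.
  have -> : polar f (s^-1 *: x) = s^-1 * polar f x.
    by apply: polarZ => //; rewrite invr_ge0 ltW.
  by rewrite mulrCA ler_pM2l ?invr_gt0// mulrC.
by rewrite -[leRHS]mul1r; apply: polar_mono => // u Su; rewrite mul1r polar_polar_le.
Qed.

End Polar.

(** * Jumps of partial derivatives of a convex function *)

Section Covering.
Variables (R : realType) (n : nat).
Local Notation V := 'rV[R]_n.

(** The list is padded with the degenerate box at 0; its volume is 0 because [0 < n], whereas an
    empty product would be 1. *)
Lemma leb_null_finite (A : set V) : (0 < n)%N ->
  (forall eps : R, 0 < eps -> exists s : seq (V * V),
     [/\ (forall p i, p \in s -> p.1 ord0 i <= p.2 ord0 i),
         (forall x, A x -> exists2 p, p \in s & box p.1 p.2 x) &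
         \sum_(p <- s) boxvol p.1 p.2 <= eps]) -> leb_null A.
Proof.
move=> n0 H eps e0; have [s [s1 s2 s3]] := H _ e0.
pose p k : V * V := nth (0, 0) s k.
have pk k i : (p k).1 ord0 i <= (p k).2 ord0 i.
  rewrite /p; case: (ltnP k (size s)) => ks; last by rewrite nth_default.
  by apply: s1; exact: mem_nth.
have v0 k : 0 <= boxvol (p k).1 (p k).2.
  by apply: prodr_ge0 => i _; rewrite subr_ge0.
exists (fun k => (p k).1), (fun k => (p k).2); split; first exact: pk.
split=> [x /s2 [q /(nthP (0, 0)) [k ks kq] bx]|N].
  by exists k => //; rewrite /p kq.
apply: le_trans s3.
rewrite (big_nth (0, 0)) -(big_mkord xpredT (fun k => boxvol (p k).1 (p k).2)).
apply: (@le_trans _ _ (\sum_(0 <= k < maxn N (size s)) boxvol (p k).1 (p k).2)).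
  rewrite (@big_cat_nat _ _ _ N 0 (maxn N (size s)))//= ?leq_maxl//.
  by rewrite lerDl sumr_ge0.
rewrite (@big_cat_nat _ _ _ (size s) 0 (maxn N (size s)))//= ?leq_maxr//.
rewrite [X in _ + X]big1_seq ?addr0// => k; rewrite mem_index_iota => /andP[_ /andP[sk _]].
rewrite /p nth_default//= /boxvol (bigD1 (Ordinal n0))//= !mxE subrr mul0r//.
Qed.

(** With [D j = G (j + m) - G j] the summand is [D (k + m) - D k], so all but [m] terms at either
    end cancel. The number of remaining terms does not grow with [M]. *)
Lemma second_difference_sum (G : nat -> R) m M :
  \sum_(k < M) (G (k + m + m)%N + G k - 2 * G (k + m)%N) =
  \sum_(l < m) ((G (M + l + m)%N - G (M + l)%N) - (G (l + m)%N - G l)).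
Proof.
elim: M => [|M IH].
  by rewrite big_ord0 big1// => l _; rewrite add0n subrr.
rewrite big_ord_recr /= IH.
rewrite !sumrB.
have E f : \sum_(l < m) (f (M.+1 + l)%N : R) = \sum_(l < m) f (M + l)%N + f (M + m)%N - f M.
  rewrite -(big_mkord xpredT (fun l => f (M.+1 + l)%N)) -(big_mkord xpredT (fun l => f (M + l)%N)).
  elim: m {IH} => [|m IH]; first by rewrite !big_geq// add0r addn0 subrr.
  by rewrite !big_nat_recr//= IH addSnnS; ring.
by rewrite (E (fun j => G (j + m)%N)) (E G); ring.
Qed.

(** Summing over all [c] and all replacements of the [i]-th coordinate meets every cell [M] times;
    this is the factor on the left. *)
Lemma sum_line (M : nat) (i : 'I_n) (F : {ffun 'I_n -> 'I_M} -> R) (B : R) :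
  (forall c : {ffun 'I_n -> 'I_M},
     \sum_(k < M) F [ffun j => if j == i then k else c j] <= B) ->
  M%:R * (\sum_c F c) <= M%:R ^+ n * B.
Proof.
move=> H.
have -> : M%:R * (\sum_c F c) =
  \sum_(c : {ffun 'I_n -> 'I_M}) \sum_(k < M) F [ffun j => if j == i then k else c j].
  rewrite pair_big /=.
  (* An involution: it exchanges the [i]-th coordinate of [c] with the free index [k]. *)
  pose s (p : {ffun 'I_n -> 'I_M} * 'I_M) : {ffun 'I_n -> 'I_M} * 'I_M :=
    ([ffun j => if j == i then p.2 else p.1 j], p.1 i).
  have si : injective s.
    apply: (can_inj (g := s)) => -[c k]; rewrite /s /=; congr (_, _).
      by apply/ffunP => j; rewrite !ffunE /=; case: eqP => // ->.
    by rewrite ffunE eqxx.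
  rewrite [RHS](eq_bigr (fun p => F (s p).1))// -(reindex_inj si (F := fun p => F p.1) (P := xpredT))/=.
  rewrite -(pair_big xpredT xpredT (fun c _ => F c)) /= mulr_sumr; apply: eq_bigr => c _.
  by rewrite sumr_const card_ord mulr_natl.
apply: le_trans (ler_sum _ (fun c _ => H c)) _.
by rewrite sumr_const card_ffun !card_ord -[leLHS]mulr_natl natrX.
Qed.

Lemma grid_cell (M : nat) (t : R) : (0 < M)%N -> -1 <= t <= 1 ->
  exists k : 'I_M, -1 + k%:R * (2 / M%:R) <= t <= -1 + k.+1%:R * (2 / M%:R).
Proof.
move=> M0 /andP[t1 t2].
have M0' : 0 < M%:R :> R by rewrite ltr0n.
pose P k := t <= -1 + k.+1%:R * (2 / M%:R).
have exP : exists k, P k.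
  exists M.-1; rewrite /P prednK// mulrCA mulfV ?gt_eqF//; lra.
have [k Pk mk] := ex_minnP exP.
have kM : (k < M)%N.
  rewrite -(prednK M0) ltnS; apply: mk; rewrite /P prednK// mulrCA mulfV ?gt_eqF//; lra.
exists (Ordinal kM) => /=; apply/andP; split; last exact: Pk.
case: k Pk mk kM => [|k] Pk mk kM; first by rewrite mul0r addr0.
by rewrite leNgt; apply/negP => /ltW h; have := mk k h; rewrite ltnn.
Qed.

(* A mesh of M^n cells of side 2/M: along each line in direction i the second
   differences telescope, so only O(1) cells per line can meet A, and these
   have total volume O(1/M). *)
Lemma leb_null_convex_jump (g : V -> R) (L delta : R) (i : 'I_n) (A : set V) :
  0 <= L -> (forall x y, `|g x - g y| <= L * `|x - y|) ->
  (forall x r, 0 <= g (x + r *: delta_mx ord0 i) + g (x - r *: delta_mx ord0 i) - 2 * g x) ->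
  0 < delta -> (forall x, A x -> `|x| <= 1) ->
  (forall x r, A x -> 0 < r ->
     delta * r <= g (x + r *: delta_mx ord0 i) + g (x - r *: delta_mx ord0 i) - 2 * g x) ->
  leb_null A.
Proof.
move=> L0 Lg Dg d0 A1 Ad.
have n0 : (0 < n)%N by apply: leq_trans (ltn_ord i).
set e := delta_mx ord0 i in Dg Ad *.
have e1 : `|e| <= 1 by apply: sphere_norm_le; exact: delta_sphere.
pose D r x := g (x + r *: e) + g (x - r *: e) - 2 * g x.
apply: leb_null_finite => // eps e0.
(* Moving the centre by at most one mesh width [eta] changes the second difference by at most
   [4 * L * eta]. With [r = m * eta] this is at most half of [delta * r]. *)
have [m m0 hm] : exists2 m : nat, (0 < m)%N & 8 * L <= m%:R * delta.
  exists (Num.truncn (8 * L / delta)).+1 => //.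
  by rewrite -ler_pdivrMr// ltW// truncnS_gt.
(* The final count gives the bad cells total volume at most [C / M]. *)
pose C := 2 ^+ n * 4 * L * m%:R / delta.
have C0 : 0 <= C by rewrite /C !mulr_ge0// invr_ge0 ltW.
have [M M0 hM] : exists2 M : nat, (0 < M)%N & C <= M%:R * eps.
  exists (Num.truncn (C / eps)).+1 => //.
  by rewrite -ler_pdivrMr// ltW// truncnS_gt.
have M0' : 0 < M%:R :> R by rewrite ltr0n.
have m0' : 0 < m%:R :> R by rewrite ltr0n.
pose eta : R := 2 / M%:R; have eta0 : 0 < eta by rewrite divr_gt0.
pose r := m%:R * eta; have r0 : 0 < r by rewrite mulr_gt0.
pose y (c : {ffun 'I_n -> 'I_M}) : V := \row_j (-1 + (c j)%:R * eta).
pose y' (c : {ffun 'I_n -> 'I_M}) : V := \row_j (-1 + (c j).+1%:R * eta).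
pose bad := [pred c | delta * r / 2 <= D r (y c)].
have yy' c j : y' c ord0 j - y c ord0 j = eta.
  by rewrite !mxE -natr1; ring.
have vol c : boxvol (y c) (y' c) = eta ^+ n.
  rewrite /boxvol (eq_bigr (fun=> eta)) => [|j _]; last exact: yy'.
  by rewrite prodr_const card_ord.
exists [seq (y c, y' c) | c <- enum bad]; split.
- move=> p j /mapP[c _ ->] /=; rewrite -subr_ge0 yy'; exact: ltW.
- move=> x Ax.
  have /fin_all_exists[c hc] : forall j, exists k : 'I_M,
      -1 + k%:R * eta <= x ord0 j <= -1 + k.+1%:R * eta.
    move=> j; apply: grid_cell => //; rewrite -ler_norml.
    by apply: le_trans (coord_norm_le _ _) (A1 _ Ax).
  pose c' : {ffun 'I_n -> 'I_M} := [ffun j => c j].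
  have xy : `|x - y c'| <= eta.
    apply: norm_le_coord => [|j]; first exact: ltW.
    rewrite !mxE ffunE; have /andP[h1 h2] := hc j.
    move: h2; rewrite -natr1 mulrDl mul1r => h2.
    by rewrite ler_norml; apply/andP; split; lra.
  exists (y c', y' c') => /=; last by move=> j; rewrite !mxE !ffunE.
  apply/mapP; exists c' => //; rewrite mem_enum inE /=.
  have h0 := Ad _ _ Ax r0.
  have := Lg x (y c'); have := Lg (x + r *: e) (y c' + r *: e).
  have := Lg (x - r *: e) (y c' - r *: e).
  rewrite (addrAC x) (addrAC x) opprD opprD !opprK addrA addrA.
  rewrite -!(addrAC _ (- y c')) subrK addrK.
  have Le : L * `|x - y c'| <= L * eta by rewrite ler_wpM2l.
  rewrite !ler_norml => /andP[a1 a2] /andP[b1 b2] /andP[c1 c2].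
  have k : 8 * L * eta <= delta * r by rewrite /r mulrA (mulrC delta) ler_wpM2r// ltW.
  rewrite /D; lra.
rewrite big_map big_enum /= (eq_bigr (fun=> eta ^+ n)) => [|c _]; last exact: vol.
have key : M%:R * (\sum_c D r (y c)) <= M%:R ^+ n * (2 * m%:R * L * r).
  apply: (sum_line (i := i)) => c.
  (* The line starts [r] before the cube, so that the left end of the second difference centred at
     cell [k] is [G k] and the centre is [G (k + m)]. *)
  pose z : V := \row_j (if j == i then -1 - r else -1 + (c j)%:R * eta).
  pose G k := g (z + (k%:R * eta) *: e).
  rewrite (eq_bigr (fun k : 'I_M => G (k + m + m)%N + G k - 2 * G (k + m)%N)); last first.
    move=> k _; rewrite /D /G.
    have -> : y [ffun j => if j == i then k else c j] = z + ((k + m)%:R * eta) *: e.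
      apply/rowP => j; rewrite !mxE !ffunE eqxx /=; case: eqP => [_|_].
        by rewrite natrD /r (_ : true%:R = 1)//; ring.
      by rewrite (_ : false%:R = 0)// mulr0 addr0.
    congr (g _ + g _ - _).
      by rewrite -addrA -scalerDl !natrD /r; congr (_ + _ *: _); ring.
    by rewrite -addrA -scalerBl !natrD /r; congr (_ + _ *: _); ring.
  rewrite second_difference_sum.
  apply: (@le_trans _ _ (\sum_(l < m) (2 * (L * r)))); last first.
    by rewrite sumr_const card_ord -mulr_natl le_eqVlt; apply/orP; left; apply/eqP; ring.
  have Gd k : `|G (k + m)%N - G k| <= L * r.
    apply: le_trans (Lg _ _) _; rewrite ler_wpM2l// opprD addrACA subrr add0r.
    rewrite -scalerBl natrD mulrDl addrAC subrr add0r normrZ ger0_norm; last exact: ltW.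
    by rewrite ler_piMr// ltW.
  apply: ler_sum => l _; have := Gd (M + l)%N; have := Gd l.
  by rewrite !ler_norml => /andP[? ?] /andP[? ?]; lra.
(* Markov's inequality for counting: convexity makes the second differences at the good cells
   nonnegative, so they may be dropped. *)
have cnt : \sum_(c | bad c) (delta * r / 2) <= \sum_c D r (y c).
  rewrite [leRHS](bigID bad)/= -[leLHS]addr0 lerD//.
    by apply: ler_sum.
  by apply: sumr_ge0 => c _; exact: Dg.
pose K : R := #|bad|%:R; have K0 : 0 <= K by rewrite /K.
have sK (z : R) : \sum_(c | bad c) z = K * z by rewrite sumr_const mulr_natl.
rewrite sK in cnt; rewrite sK.
have : M%:R * (K * (delta * r / 2)) <= M%:R ^+ n * (2 * m%:R * L * r).
  by apply: le_trans key; rewrite ler_wpM2l// ltW.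
have -> : M%:R * (K * (delta * r / 2)) = (M%:R * K * delta / 2) * r by ring.
rewrite mulrA ler_pM2r// => h.
have E : M%:R * eta = 2 by rewrite /eta mulrCA mulfV ?mulr1// gt_eqF.
have h2 : M%:R * (K * eta ^+ n) * delta <= 2 ^+ n * 4 * L * m%:R.
  have -> : M%:R * (K * eta ^+ n) * delta = 2 * (eta ^+ n * (M%:R * K * delta / 2)) by field.
  have -> : 2 ^+ n * 4 * L * m%:R = 2 * (eta ^+ n * (M%:R ^+ n * (2 * m%:R * L))).
    have <- : M%:R ^+ n * eta ^+ n = 2 ^+ n by rewrite -exprMn E.
    by ring.
  by rewrite ler_pM2l// ler_pM2l// exprn_gt0.
rewrite -(ler_pM2l M0'); apply: le_trans hM.
by rewrite /C ler_pdivlMr.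
Qed.

End Covering.

(** * Integration over the sphere *)

Section LowerIntegral.
Context d (T : measurableType d) (R : realType) (mu : {measure set T -> \bar R}).
Local Open Scope ereal_scope.
Import HBNNSimple.

(* No measurability is assumed here: the integral of a nonnegative function is
   defined as a supremum over simple functions below it. *)
Lemma ge0_le_lower_integral (D E : set T) (f g : T -> \bar R) :
  (forall x, D x -> 0 <= f x) -> (forall x, E x -> 0 <= g x) ->
  (forall x, (f \_ D) x <= (g \_ E) x) ->
  \int[mu]_(x in D) f x <= \int[mu]_(x in E) g x.
Proof.
move=> f0 g0 fg; rewrite (ge0_integralE mu f0) (ge0_integralE mu g0).
apply: ge_ereal_sup => _ [h hf <-]; apply: ereal_sup_ubound; exists h => // x.
exact: le_trans (hf x) (fg x).
Qed.

(** Neither [D] nor [f] is measurable here, so the null set is cut out of each simple function below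
    the integrand rather than out of the integrand. *)
Lemma ge0_lower_integral_setD (D N : set T) (f : T -> \bar R) :
  (forall x, D x -> 0 <= f x) -> measurable N -> mu N = 0 ->
  \int[mu]_(x in D) f x = \int[mu]_(x in D `\` N) f x.
Proof.
move=> f0 mN N0.
have f0' x : (D `\` N) x -> 0 <= f x by move=> [/f0].
apply/eqP; rewrite eq_le; apply/andP; split; last first.
  apply: ge0_le_lower_integral => // x; rewrite !patchE.
  case: ifPn => [/set_mem[Dx _]|_]; first by rewrite mem_set.
  by case: ifPn => // /set_mem /f0.
rewrite (ge0_integralE mu f0) (ge0_integralE mu f0').
apply: ge_ereal_sup => _ [h hf <-].
pose h' := proj_nnsfun h (measurableC mN).
apply: (@le_trans _ _ (sintegral mu h')); last first.
  apply: ereal_sup_ubound; exists h' => // x; have := hf x.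
  rewrite /h' /= mindicE /patch !in_setD in_setC; case: (x \in N) => /=.
    by rewrite mulr0 andbF lexx.
  by rewrite mulr1 andbT.
rewrite -!integralT_nnsfun (@ge0_negligible_integral _ _ _ mu setT N)//=; last 2 first.
  - exact/measurable_EFinP/measurable_funP.
  - by move=> x _; rewrite lee_fin; exact: fun_ge0.
apply: ge0_le_lower_integral => [x _|x _|x].
- by rewrite lee_fin; exact: fun_ge0.
- by rewrite lee_fin; exact: (fun_ge0 x (s := h')).
rewrite !patch_setT patchE /= mindicE in_setD in_setC in_setT /=.
by case: (x \in N) => /=; rewrite lee_fin ?mulr1 ?mulr0.
Qed.

End LowerIntegral.

(** * Bounded Borel functions on the sphere and the mass of caps *)

Section SphereIntegral.
Variables (R : realType) (n : nat).
Local Notation V := 'rV[R]_n.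
Local Notation BV := (borelV R n).
Local Notation S := (@sphere R n : set BV).
Implicit Types (f g : V -> R) (A : set BV) (c : R).

Lemma open_borelV (A : set V) : open A -> measurable (A : set BV).
Proof. by move=> oA; apply: sub_sigma_algebra. Qed.

Lemma closed_borelV (A : set V) : closed A -> measurable (A : set BV).
Proof.
by move=> cA; rewrite -(setCK A); apply: measurableC; apply: open_borelV; exact: closed_openC.
Qed.

Lemma measurable_sphere : measurable S.
Proof. by apply: closed_borelV; exact: closed_sphere. Qed.

Lemma csph_measurable f : csph f -> measurable_fun S (f : BV -> R).
Proof.
move=> /continuousP cf; apply: (measurability _ (RGenOpens.measurableE R)).
move=> _ [_ [a [b ->] <-]].
have /open_subspaceP[U oU OE] := cf _ (@interval_open _ (BRight a) (BLeft b) isT isT).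
by rewrite setIC -OE; apply: measurableI; [exact: open_borelV|exact: measurable_sphere].
Qed.

Definition bmeas f := measurable_fun S (f : BV -> R) /\
  exists M, forall u, S u -> `|f u| <= M.

Lemma csph_bmeas f : (0 < n)%N -> csph f -> bmeas f.
Proof.
move=> n0 cf; split; first exact: csph_measurable.
by have [b _ hb] := csph_bound n0 cf; exists b.
Qed.

Lemma bmeasD f g : bmeas f -> bmeas g -> bmeas (fun u => f u + g u).
Proof.
move=> [mf [M hM]] [mg [N hN]]; split; first exact: measurable_funD.
exists (M + N) => u Su; apply: le_trans (ler_normD _ _) _.
by rewrite lerD// ?hM ?hN.
Qed.

Lemma bmeasZ f c : bmeas f -> bmeas (fun u => c * f u).
Proof.
move=> [mf [M hM]]; split; first exact: measurable_funM.
by exists (`|c| * M) => u Su; rewrite normrM ler_wpM2l// hM.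
Qed.

Lemma bmeas_cst c : bmeas (fun=> c).
Proof. by split; [exact: measurable_cst|exists `|c|]. Qed.

Lemma bmeas_indic A : measurable A -> bmeas (\1_A).
Proof.
move=> mA; split; first exact: measurable_indic.
by exists 1 => u _; rewrite indicE; case: (u \in A); rewrite ?normr1 ?normr0.
Qed.

Variable mu : {measure set BV -> \bar R}.
Hypothesis mufin : (mu setT < +oo)%E.

Lemma measure_lty A : measurable A -> (mu A < +oo)%E.
Proof. by move=> mA; apply: le_lt_trans mufin; apply: le_measure; rewrite ?inE. Qed.

Lemma measure_fin A : measurable A -> mu A \is a fin_num.
Proof. by move=> mA; rewrite ge0_fin_numE// measure_lty. Qed.

Lemma bmeas_integrable f : bmeas f -> mu.-integrable S (EFin \o f).
Proof.
move=> [mf [M hM]]; apply: measurable_bounded_integrable => //.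
- exact: measurable_sphere.
- by apply: measure_lty; exact: measurable_sphere.
exists M; split; first exact: num_real.
by move=> N MN u Su; apply: le_trans (hM u Su) (ltW MN).
Qed.

Definition sint f := \int[mu]_(u in S) f u.

Lemma sint_le f g : bmeas f -> bmeas g -> (forall u, S u -> f u <= g u) ->
  sint f <= sint g.
Proof.
move=> bf bg fg; apply: le_Rintegral => //; first exact: measurable_sphere.
- exact: bmeas_integrable.
- exact: bmeas_integrable.
Qed.

Lemma sint_eq f g : (forall u, S u -> f u = g u) -> sint f = sint g.
Proof. by move=> fg; apply: eq_Rintegral => u /set_mem /fg. Qed.

Lemma sintD f g : bmeas f -> bmeas g -> sint (fun u => f u + g u) = sint f + sint g.
Proof.
move=> bf bg; apply: RintegralD; first exact: measurable_sphere.
- exact: bmeas_integrable.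
- exact: bmeas_integrable.
Qed.

Lemma sintZ f c : bmeas f -> sint (fun u => c * f u) = c * sint f.
Proof.
move=> bf; apply: RintegralZl; first exact: measurable_sphere.
exact: bmeas_integrable.
Qed.

Lemma sint_cst c : sint (fun=> c) = c * fine (mu S).
Proof. by rewrite /sint Rintegral_cst//; exact: measurable_sphere. Qed.

Lemma sint_indic A : measurable A -> A `<=` S -> sint (\1_A) = fine (mu A).
Proof. by move=> mA AS; rewrite /sint /Rintegral (integral_indic mu measurable_sphere mA) setIidl. Qed.

Lemma sintE f : bmeas f -> (\int[mu]_(u in S) (f u)%:E = (sint f)%:E)%E.
Proof.
move=> bf; rewrite /sint /Rintegral fineK//.
by apply: integrable_fin_num; [exact: measurable_sphere|exact: bmeas_integrable].
Qed.

Lemma sint_dist f g c : bmeas f -> bmeas g ->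
  (forall u, S u -> `|f u - g u| <= c) -> `|sint f - sint g| <= c * fine (mu S).
Proof.
move=> bf bg h; have bc := bmeas_cst c.
have h1 : sint f <= sint g + c * fine (mu S).
  rewrite -sint_cst -sintD//; apply: sint_le => // [|u /h]; first exact: bmeasD.
  by rewrite ler_norml => /andP[? ?]; lra.
have h2 : sint g <= sint f + c * fine (mu S).
  rewrite -sint_cst -sintD//; apply: sint_le => // [|u /h]; first exact: bmeasD.
  by rewrite ler_norml => /andP[? ?]; lra.
by rewrite ler_norml; apply/andP; split; lra.
Qed.

Definition cap (v : V) c : set BV := [set u | S u /\ c < dotp v u].

Lemma measurable_cap v c : measurable (cap v c).
Proof.
rewrite (_ : cap v c = S `&` [set u : V | c < dotp v u])//.
apply: measurableI; first exact: measurable_sphere.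
apply: open_borelV; rewrite (_ : [set u : V | c < dotp v u] = (fun u : V => dotp u v) @^-1` [set x | c < x]).
  by apply: open_comp => [u _|]; [exact: continuous_dotp|exact: open_gt].
by apply/seteqP; split => u /=; rewrite dotpC.
Qed.

Lemma csph_dotp (v : V) : csph (fun u : V => dotp v u).
Proof.
apply: (@csph_eq R n (fun u : V => dotp u v)) => [u _|]; first exact: dotpC.
exact/continuous_csph/continuous_dotp.
Qed.

Lemma csph_dotp_pos (v : V) : csph (fun u : V => Num.max (dotp v u) 0).
Proof.
move=> x; apply: (@continuous_max _ _ (fun u : subspace (@sphere R n) => dotp v u) (fun=> 0)).
  exact: csph_dotp.
exact: cvg_cst.
Qed.

(* Compactness makes the mass of a cap bounded below uniformly in its centre. *)
Lemma not_concentrated_cap : (0 < n)%N -> not_concentrated mu ->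
  exists a delta : R, [/\ 0 < a, 0 < delta &
    forall v, S v -> a <= fine (mu (cap v delta))].
Proof.
move=> n0 nc; set m := fine (mu S).
have m0 : 0 <= m by exact: fine_ge0.
have bp (v : V) : bmeas (fun u : V => Num.max (dotp v u) 0).
  by apply: csph_bmeas => //; exact: csph_dotp_pos.
pose F (v : V) := sint (fun u : V => Num.max (dotp v u) 0).
have cF : cpos F.
  split=> [|v Sv]; last by rewrite -lte_fin -sintE//; exact: nc.
  apply: continuous_csph; apply: (@lipschitz_continuous _ _ _ (n%:R * m)) => x y.
  rewrite mulrAC; apply: sint_dist => // u Su.
  have := sphere_dotp_norm (x - y) Su; rewrite dotpBl !ler_norml.
  by rewrite /Num.max; do 2 case: ltP => ?; move=> /andP[? ?]; apply/andP; split; lra.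
have [c c0 hc] := cpos_min n0 cF.
(* The integrand of [F v] is at most [delta] off the cap and at most 1 on it, so [F v] is at most
   [delta * m] plus the mass of the cap. This [delta] makes the first term at most [c / 2]; [m + 1]
   keeps the denominator positive. *)
exists (c / 2), (c / (2 * (m + 1))); split; first by rewrite divr_gt0.
  by rewrite divr_gt0// mulr_gt0// ltr_wpDl.
move=> v Sv; set del := c / (2 * (m + 1)).
have mc : measurable (cap v del) by exact: measurable_cap.
have : F v <= sint (fun u => del + \1_(cap v del) u).
  apply: sint_le => // [|u Su].
    by apply: bmeasD; [exact: bmeas_cst|exact: bmeas_indic].
  have d0 : 0 < del by rewrite divr_gt0// mulr_gt0// ltr_wpDl.
  rewrite indicE; case: (boolP (u \in _)) => [_|/negP uA].
    by rewrite ge_max; have := dotp_sphere_le1 Sv Su => ?; apply/andP; split; rewrite /=; lra.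
  rewrite addr0 ge_max (ltW d0) andbT leNgt; apply/negP => h; apply: uA.
  exact/mem_set.
rewrite sintD ?sint_cst ?sint_indic//; first last.
- exact: bmeas_indic.
- exact: bmeas_cst.
- by move=> u [].
have := hc v Sv; have : del * m <= c / 2.
  rewrite /del -[leRHS]mulr1 (_ : _ * m = c / 2 * (m / (m + 1))); last first.
    by field; rewrite gt_eqF// ltr_wpDl.
  by rewrite ler_pM2l ?divr_gt0// ler_pdivrMr ?ltr_wpDl// mul1r lerDl.
by rewrite -/m; lra.
Qed.

End SphereIntegral.

(** * Regularity of Psi *)

Section CompactUniform.
Variable (R : realType).

(** A property that holds locally for all small [d] holds on a compact set for one common [d].
    Uniform upper bounds follow from the same statement by writing the bound as [d^-1]. *)
Lemma compact_uniform_radius (T : topologicalType) (K : set T) (P : R -> T -> Prop) :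
  compact K ->
  (forall x, K x -> exists2 U, nbhs x U &
     exists2 e, 0 < e & forall y d, U y -> K y -> 0 < d -> d < e -> P d y) ->
  exists2 d, 0 < d & forall x, K x -> P d x.
Proof.
move=> /compact_near_coveringP/near_covering_withinP cK H.
have : \forall d \near (0 : R)^'+, K `<=` P d.
  apply: cK => x Kx; have [U xU [e e0 he]] := H x Kx.
  exists (U, [set d | 0 < d < e]) => /=.
    split => //=; near=> d; apply/andP; split; first by near: d; exact: nbhs_right_gt.
    by near: d; exact: nbhs_right_lt.
  by move=> [y d] /= [Uy /andP[d0 de]] Ky; exact: he.
move=> /(filterI (nbhs_right_gt (0 : R))) /filter_ex [d [d0 hd]].
by exists d.
Unshelve. all: by end_near. Qed.

Lemma compact_sublevel (T : topologicalType) (K : set T) (F : T -> R) (c : R) :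
  compact K -> {within K, continuous F} -> compact (K `&` [set x | F x <= c]).
Proof.
move=> cK cF.
have /closed_subspaceP[W cW WE] : closed ((F @^-1` [set y | y <= c]) : set (subspace K)).
  by apply: closed_comp => [x _|]; [exact: cF|exact: closed_le].
rewrite setIC -[X in X `&` K]/(F @^-1` [set y | y <= c]) -WE.
by rewrite setIC; exact: compact_closedI.
Qed.

End CompactUniform.

(** * Estimates for Psi and its derivative, uniform over the sphere *)

Section Psi.
Variables (R : realType) (n : nat).
Local Notation V := 'rV[R]_n.
Local Notation S := (@sphere R n).

Local Notation dom := [set p : V * R | S p.1 /\ 0 < p.2].

Lemma within_dom_eps (F : V -> R -> R) :
  {within dom, continuous (fun p => F p.1 p.2)} ->
  forall u t eps, S u -> 0 < t -> 0 < eps -> exists2 d, 0 < d &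
    forall v s, S v -> 0 < s -> `|u - v| < d -> `|t - s| < d -> `|F u t - F v s| < eps.
Proof.
move=> /subspace_continuousP cF u t eps Su t0 e0.
have /(_ (conj Su t0)) := cF (u, t).
move=> /(_ _ (nbhsx_ballx _ _ e0)) /nbhs_ballP [d /= d0 hd].
exists d => // v s Sv s0 uv ts.
apply: (hd (v, s)) => //; split => /=; last by rewrite /ball /=.
by rewrite -ball_normE.
Qed.

Lemma csph_eps (f : V -> R) : csph f ->
  forall u eps, S u -> 0 < eps -> exists2 d, 0 < d &
    forall v, S v -> `|u - v| < d -> `|f u - f v| < eps.
Proof.
move=> /subspace_continuousP cf u eps Su e0.
have /(_ _ (nbhsx_ballx _ _ e0)) /nbhs_ballP [d /= d0 hd] := cf u Su.
by exists d => // v Sv uv; apply: (hd v) => //; rewrite -ball_normE.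
Qed.

Lemma eps_csph (f : V -> R) :
  (forall u eps, S u -> 0 < eps -> exists2 d, 0 < d &
    forall v, S v -> `|u - v| < d -> `|f u - f v| < eps) -> csph f.
Proof.
move=> H; apply/subspace_continuousP => u Su A /nbhs_ballP[e /= e0 eA].
have [d d0 hd] := H u e Su e0.
apply/nbhs_ballP; exists d => //= v; rewrite -ball_normE /= => uv Sv.
by apply: eA; rewrite /ball /=; exact: hd.
Qed.

Lemma csph_comp_dom (F : V -> R -> R) h :
  {within dom, continuous (fun p => F p.1 p.2)} -> cpos h ->
  csph (fun u => F u (h u)).
Proof.
move=> cF [ch h0]; apply: eps_csph => u e Su e0.
have [d d0 hd] := within_dom_eps cF Su (h0 _ Su) e0.
have [d' d'0 hd'] := csph_eps ch Su d0.
exists (Num.min d d') => [|v Sv]; first by rewrite lt_min d0.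
rewrite lt_min => /andP[uv uv']; apply: hd => //; first exact: h0.
exact: hd'.
Qed.

Lemma compact_sphere_itv (a b : R) : compact (S `*` `[a, b]%classic).
Proof. by apply: compact_setX; [exact: compact_sphere|exact: segment_compact]. Qed.

Lemma dom_unif_cont (F : V -> R -> R) :
  {within dom, continuous (fun p => F p.1 p.2)} ->
  forall a b eps, 0 < a -> 0 < eps -> exists2 d, 0 < d &
    forall u s t, S u -> a <= s <= b -> a <= t <= b -> `|s - t| < d ->
      `|F u s - F u t| < eps.
Proof.
move=> cF a b eps a0 e0.
have [|d d0 hd] := @compact_uniform_radius R _ _
  (fun d (p : V * R) => forall t, a <= t <= b -> `|p.2 - t| < d ->
     `|F p.1 p.2 - F p.1 t| < eps) (@compact_sphere_itv a b).
  move=> [u s] [/= Su]; rewrite in_itv /= => /andP[as_ sb].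
  have s0 : 0 < s by apply: lt_le_trans as_.
  have e2 : 0 < eps / 2 by rewrite divr_gt0.
  have [d d0 hd] := within_dom_eps cF Su s0 e2.
  exists (ball (u, s) (d / 2)); first by apply: nbhsx_ballx; rewrite divr_gt0.
  exists (d / 2); first by rewrite divr_gt0.
  move=> [v s'] d' [/=]; rewrite -ball_normE /= {1}/ball /= => uv ss [/= Sv].
  rewrite in_itv /= => /andP[as' s'b] d'0 d'd t /andP[at_ tb] s't.
  have dd2 : d / 2 < d by lra.
  have h1 := hd v s' Sv (lt_le_trans a0 as') (lt_trans uv dd2) (lt_trans ss dd2).
  have st : `|s - t| < d.
    by apply: le_lt_trans (ler_distD s' _ _) _; lra.
  have h2 := hd v t Sv (lt_le_trans a0 at_) (lt_trans uv dd2) st.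
  apply: le_lt_trans (ler_distD (F u s) _ _) _; rewrite (distrC (F v s')); lra.
exists d => // u s t Su sab tab st; apply: (hd (u, s)).
  by split => //=; rewrite in_itv.
- exact: tab.
- exact: st.
Qed.

Lemma dom_bounded (F : V -> R -> R) :
  {within dom, continuous (fun p => F p.1 p.2)} ->
  forall a b, 0 < a -> exists2 M, 0 < M &
    forall u s, S u -> a <= s <= b -> `|F u s| <= M.
Proof.
move=> cF a b a0.
have [|d d0 hd] := @compact_uniform_radius R _ _
  (fun d (p : V * R) => `|F p.1 p.2| <= d^-1) (@compact_sphere_itv a b).
  move=> [u s] [/= Su]; rewrite in_itv /= => /andP[as_ sb].
  have s0 : 0 < s by apply: lt_le_trans as_.
  have [d d0 hd] := within_dom_eps cF Su s0 ltr01.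
  exists (ball (u, s) d); first exact: nbhsx_ballx.
  have F1 : 0 < `|F u s| + 1 by rewrite ltr_wpDl.
  exists (`|F u s| + 1)^-1; first by rewrite invr_gt0.
  move=> [v s'] d' [/=]; rewrite -ball_normE /= {1}/ball /= => uv ss [/= Sv].
  rewrite in_itv /= => /andP[as' s'b] d'0.
  rewrite -[X in X < _]invrK ltf_pV2 ?posrE ?invr_gt0// => d'd.
  have h1 := hd v s' Sv (lt_le_trans a0 as') uv ss.
  apply: le_trans (ltW d'd); rewrite -lerBlDl.
  apply: le_trans (ltW h1); rewrite distrC; exact: lerB_dist.
exists d^-1; first by rewrite invr_gt0.
by move=> u s Su sab; apply: (hd (u, s)); split => //=; rewrite in_itv.
Qed.

Variable Psi : V -> R -> R.
Hypothesis GI : G_I Psi.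

Lemma psi_gt0 u t : S u -> 0 < t -> 0 < Psi u t.
Proof. by case: GI => h _; exact: h. Qed.

Lemma psit_gt0 u t : S u -> 0 < t -> 0 < Psi_t Psi u t.
Proof. by case: GI => _ [_ [_ [_ [h _]]]]; exact: h. Qed.

Lemma psi_cont : {within dom, continuous (fun p => Psi p.1 p.2)}.
Proof. by case: GI => _ [_ []]. Qed.

Lemma psit_cont : {within dom, continuous (fun p => Psi_t Psi p.1 p.2)}.
Proof. by case: GI => _ [_ [_ []]]. Qed.

Lemma psi_MVT u s t : S u -> 0 < s -> s <= t ->
  exists2 c, s <= c <= t & Psi u t - Psi u s = Psi_t Psi u c * (t - s).
Proof.
move=> Su s0 st.
have dP x : 0 < x -> derivable (Psi u) x 1 by case: GI => _ [h _]; exact: h.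
have [x| |c] := @MVT_segment R (Psi u) (Psi_t Psi u) s t st.
- rewrite in_itv /= => /andP[sx _]; rewrite /Psi_t derive1E.
  by apply: DeriveDef => //; apply: dP; exact: lt_trans sx.
- apply: derivable_within_continuous => x; rewrite in_itv /= => /andP[sx _].
  by apply: dP; exact: lt_le_trans sx.
by rewrite in_itv /= => cst E; exists c.
Qed.

(** A perturbation may raise or lower [h u] according to the sign of [phi u], so the mean value
    theorem is needed without knowing the order of [s] and [t]. *)
Lemma psi_MVT_dist u s t : S u -> 0 < s -> 0 < t ->
  exists2 c, `|c - s| <= `|t - s| & Psi u t - Psi u s = Psi_t Psi u c * (t - s).
Proof.
move=> Su s0 t0; case: (leP s t) => [st|/ltW ts].
  have [c /andP[sc ct] E] := psi_MVT Su s0 st.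
  by exists c => //; rewrite !ger0_norm ?subr_ge0// lerD2r.
have [c /andP[tc cs] E] := psi_MVT Su t0 ts.
exists c; last by rewrite -opprB E -mulrN opprB.
by rewrite distrC (distrC t) !ger0_norm ?subr_ge0// lerB.
Qed.

Lemma psi_mono u s t : S u -> 0 < s -> s <= t -> Psi u s <= Psi u t.
Proof.
move=> Su s0 st; have [c /andP[sc ct] E] := psi_MVT Su s0 st.
rewrite -subr_ge0 E mulr_ge0 ?subr_ge0// ltW//.
by apply: psit_gt0 => //; exact: lt_le_trans sc.
Qed.

(** As in Dini's theorem: a large value at one [T'] persists at nearby directions, and monotonicity
    in [t] carries it to all larger arguments, so a common one exists by compactness. *)
Lemma psi_large B : exists2 T, 0 < T & forall u, S u -> B <= Psi u T.
Proof.
have [|d d0 hd] := @compact_uniform_radius R _ _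
  (fun d (u : V) => B <= Psi u d^-1) (@compact_sphere R n).
  move=> u Su; have : Psi u t @[t --> +oo] --> +oo.
    by case: GI => _ [_ [_ [_ [_ [_ h]]]]]; exact: h.
  move=> /cvgryPgt/(_ (B + 1)) [T [_ hT]].
  pose T' := Num.max T 0 + 1.
  have T'0 : 0 < T' by rewrite /T' ltr_wpDl// le_max lexx orbT.
  have TT' : T < T' by rewrite /T' (@le_lt_trans _ _ (Num.max T 0)) ?ltrDl// le_max lexx.
  have hB := hT _ TT'.
  have [d d0 hd] := within_dom_eps psi_cont Su T'0 ltr01.
  exists (ball u d); first exact: nbhsx_ballx.
  exists T'^-1; first by rewrite invr_gt0.
  move=> v d'; rewrite -ball_normE /= => uv Sv d'0.
  rewrite -[X in X < _]invrK ltf_pV2 ?posrE ?invr_gt0// => Td'.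
  have := hd v T' Sv T'0 uv; rewrite subrr normr0 => /(_ d0).
  have := psi_mono Sv T'0 (ltW Td').
  by rewrite ltr_norml => ? /andP[? ?]; lra.
by exists d^-1 => //; rewrite invr_gt0.
Qed.

End Psi.

(** * The minimization problem *)

Section LipschitzClass.
Variables (R : realType) (n : nat).
Local Notation V := 'rV[R]_n.
Local Notation S := (@sphere R n).
Local Notation X := {ptws V -> R}.
Variables (r L : R).
Hypotheses (r0 : 0 < r) (L0 : 0 < L).

Definition lipschitz_class : set X := [set h |
  [/\ forall x : V, `|h x| <= L * `|x|, forall x y : V, `|h x - h y| <= L * `|x - y|
    & forall u, S u -> r <= h u]].

Lemma continuous_eval (x : V) : continuous (fun h : X => h x).
Proof. by move=> h; exact: (@proj_continuous V (fun _ => R) x h). Qed.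

(** The growth bound puts the class into a product of compact segments and the other conditions are
    closed pointwise, so Tychonoff's theorem does the work of Arzelà-Ascoli. *)
Lemma compact_lipschitz_class : compact lipschitz_class.
Proof.
have cT := @tychonoff V (fun _ => R) (fun x => `[- (L * `|x|), L * `|x| ]%classic)
  (fun x => @segment_compact _ _ _).
have c1 : closed (\bigcap_(p in [set: V * V])
    [set h : X | `|h p.1 - h p.2| <= L * `|p.1 - p.2|]).
  apply: closed_bigI => -[x y] _ /=.
  apply: (@closed_comp _ _ (fun h : X => `|h x - h y|) [set z | z <= L * `|x - y|]).
    by move=> h _; exact: (cvg_norm (cvgB (@continuous_eval x h) (@continuous_eval y h))).
  exact: closed_le.
have c2 : closed (\bigcap_(u in S) [set h : X | r <= h u]).
  apply: closed_bigI => u Su /=.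
  apply: (@closed_comp _ _ (fun h : X => h u) [set z | r <= z]).
    move=> h _; exact: continuous_eval.
  exact: closed_ge.
have cK := compact_closedI (compact_closedI cT c1) c2.
suff -> : lipschitz_class = [set f | forall i : V, `[- (L * `|i|), L * `|i| ]%classic (f i)] `&`
  (\bigcap_(p in [set: V * V]) [set h : X | `|h p.1 - h p.2| <= L * `|p.1 - p.2|])
  `&` (\bigcap_(u in S) [set h : X | r <= h u]) by exact: cK.
apply/seteqP; split => h.
  move=> [h1 h2 h3]; split; last by move=> u Su; exact: h3.
  split; last by move=> -[x y] _; exact: h2.
  by move=> x /=; rewrite in_itv /= -ler_norml.
move=> [[h1 h2] h3]; split => [x|x y|u Su].
- by have := h1 x; rewrite /= in_itv /= -ler_norml.
- by have := h2 (x, y); exact.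
- exact: h3.
Qed.

(** Equicontinuity: near a point [u] of the sphere the value at [u] controls both functions up to
    [2 * eta / 3], so pointwise closeness is uniform closeness. *)
Lemma lipschitz_class_near h eta : lipschitz_class h -> 0 < eta ->
  \forall h' \near (h : X), lipschitz_class h' -> forall u, S u -> `|h' u - h u| < eta.
Proof.
move=> Hh e0.
have /compact_near_coveringP/near_covering_withinP cS := @compact_sphere R n.
have : \forall h' \near (h : X), S `<=` (fun u : V => lipschitz_class h' -> `|h' u - h u| < eta).
  apply: (cS X (nbhs (h : X)) (fun h' (u : V) => lipschitz_class h' -> `|h' u - h u| < eta)
    (nbhs_filter (h : X))) => u Su.
  have e30 : 0 < eta / 3 by rewrite divr_gt0.
  have d0 : 0 < eta / 3 / L by rewrite divr_gt0.
  exists (ball u (eta / 3 / L), [set h' : X | `|h u - h' u| < eta / 3]) => /=.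
    split; first exact: nbhsx_ballx.
    exact: (continuous_eval (nbhsx_ballx (h u) _ e30)).
  move=> [v h'] /= [uv hu] Sv Hh'.
  have {}uv : `|u - v| < eta / 3 / L by move: uv; rewrite -ball_normE.
  case: Hh => _ Lh _; case: Hh' => _ Lh' _.
  have Luv : L * `|u - v| < eta / 3 by rewrite mulrC -ltr_pdivlMr.
  have h1 := Lh u v; have h2 := Lh' u v.
  apply: le_lt_trans (ler_distD (h' u) _ _) _.
  apply: (@le_lt_trans _ _ (`|h' v - h' u| + (`|h' u - h u| + `|h u - h v|))).
    by rewrite lerD2l; exact: ler_distD.
  rewrite (distrC (h' v)) (distrC _ (h u)); lra.
by apply: filterS => h' hh Hh' u Su; exact: hh.
Qed.

Lemma lipschitz_class_continuous (F : X -> R) :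
  (forall h eps, lipschitz_class h -> 0 < eps -> exists2 eta, 0 < eta &
     forall h', lipschitz_class h' -> (forall u, S u -> `|h' u - h u| < eta) ->
       `|F h - F h'| < eps) ->
  {within lipschitz_class, continuous F}.
Proof.
move=> H; apply/subspace_continuousP => h Hh A /nbhs_ballP[e /= e0 eA].
have [eta eta0 heta] := H h e Hh e0.
have := lipschitz_class_near Hh eta0; apply: filterS => h' hh' Hh'.
by apply: eA; rewrite /ball /=; apply: heta => //; exact: hh'.
Qed.

Lemma lipschitz_class_cpos h : lipschitz_class h -> cpos h.
Proof.
move=> [_ Lh rh]; split; first by apply: continuous_csph; exact: lipschitz_continuous Lh.
by move=> u /rh; exact: lt_le_trans.
Qed.

Lemma lipschitz_class_itv h u : lipschitz_class h -> S u -> r <= h u <= L.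
Proof.
move=> [Bh _ rh] Su; rewrite rh//=.
have := Bh u; rewrite ler_norml => /andP[_ hu]; apply: le_trans hu _.
by rewrite ler_piMr ?sphere_norm_le// ltW.
Qed.

End LipschitzClass.

(** * A priori bounds and existence of a minimizer *)

Section Minimizer.
Variables (R : realType) (n : nat) (n0 : (0 < n)%N).
Local Notation V := 'rV[R]_n.
Local Notation S := (@sphere R n).
Variables (lam mu : {measure set (borelV R n) -> \bar R}).
Hypotheses (lamfin : (lam setT < +oo)%E) (mufin : (mu setT < +oo)%E).
Hypotheses (lamnc : not_concentrated lam) (munc : not_concentrated mu).
Variable Psi : V -> R -> R.
Hypothesis GI : G_I Psi.

Definition feasible (f : V -> R) := cpos f /\
  sint mu (fun u : V => Psi u (f u)) <= sint mu (fun u : V => Psi u 1).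

Definition entropy (f : V -> R) := sint lam (fun x : V => ln (polar f x)).

Lemma csph_ln f : cpos f -> csph (fun x : V => ln (f x)).
Proof.
move=> [cf f0]; rewrite /csph continuous_subspace_in => x /set_mem Sx.
by apply: (continuous_comp (cf x)); apply: continuous_ln; exact: f0.
Qed.

Lemma bmeas_psi f : cpos f -> bmeas (fun u : V => Psi u (f u)).
Proof.
by move=> cf; apply: csph_bmeas => //; apply: csph_comp_dom => //; exact: psi_cont.
Qed.

Lemma bmeas_entropy f : cpos f -> bmeas (fun x : V => ln (polar f x)).
Proof. by move=> cf; apply: csph_bmeas => //; apply: csph_ln; exact: polar_cpos. Qed.

Lemma cpos1 : cpos (fun _ : V => 1 : R).
Proof. by split => //; exact: csph_cst. Qed.

Lemma polar1 x : S x -> polar (fun _ : V => 1 : R) x = 1.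
Proof.
move=> Sx; apply/eqP; rewrite eq_le; apply/andP; split.
  by apply: polar_le cpos1 _ => // u Su; rewrite mulr1 dotp_sphere_le1.
by have := polar_ge x n0 cpos1 Sx; rewrite Sx mulr1.
Qed.

Lemma entropy1 : entropy (fun=> 1) = 0.
Proof.
rewrite /entropy (@sint_eq _ _ _ _ (fun=> 0)) ?sint_cst ?mul0r// => u Su.
by rewrite polar1// ln1.
Qed.

Lemma feasible1 : feasible (fun=> 1).
Proof. by split => //; exact: cpos1. Qed.

Lemma feasible_polar2 f : feasible f -> feasible (polar (polar f)).
Proof.
move=> [cf hf]; have c2 := polar_cpos n0 (polar_cpos n0 cf).
split => //; apply: le_trans hf; apply: sint_le => //; try exact: bmeas_psi.
move=> u Su; apply: psi_mono => //; first exact: c2.2.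
exact: polar_polar_le.
Qed.

Lemma entropy_polar2 f : cpos f -> entropy (polar (polar f)) = entropy f.
Proof. by move=> cf; apply: sint_eq => u Su; rewrite polar3. Qed.

(** If the radial function at [x] exceeded [T / de], then [polar (polar f)] would be at least [T] on
    the cap around [x]. The cap has [mu]-mass at least [a] and [Psi] is at least [(c0 + 1) / a]
    there, so the constraint integral would exceed its bound [c0]. *)
Lemma polar2_upper : exists2 b, 1 <= b &
  forall f, feasible f -> forall x, S x -> b^-1 <= polar f x.
Proof.
have [a [de [a0 de0 ha]]] := not_concentrated_cap mufin n0 munc.
set c0 := sint mu (fun u : V => Psi u 1).
have [T T0 hT] := psi_large GI ((c0 + 1) / a).
exists (Num.max 1 (T / de)); first by rewrite le_max lexx.
have b0 : 0 < Num.max 1 (T / de) by rewrite lt_max ltr01.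
move=> f ff x Sx; rewrite leNgt; apply/negP => h.
have [cf _] := ff; have cg := polar_cpos n0 cf; have ch := polar_cpos n0 cg.
have g0 := cg.2 _ Sx.
have {}h : T / de < (polar f x)^-1.
  rewrite -[X in _ < X]invrK; move: h; rewrite -[X in X < _]invrK ltf_pV2 ?posrE ?invr_gt0//.
  by rewrite gt_max invrK => /andP[].
have mc : measurable (cap x de) by exact: measurable_cap.
have cT u : cap x de u -> T <= polar (polar f) u.
  move=> [Su du]; have := polar_ge u n0 cg Sx; rewrite dotpC -ler_pdivrMr//.
  apply: le_trans; move: h; rewrite ltr_pdivrMr// => /ltW h; apply: le_trans h _.
  by rewrite mulrC ler_pM2r ?invr_gt0// ltW.
have : sint mu (fun u => (c0 + 1) / a * \1_(cap x de) u) <=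
    sint mu (fun u : V => Psi u (polar (polar f) u)).
  apply: sint_le => //.
  - by apply: bmeasZ; exact: bmeas_indic.
  - exact: bmeas_psi.
  move=> u Su; rewrite indicE; case: (boolP (u \in _)) => [/set_mem cu|_].
    rewrite mulr1; apply: le_trans (hT u Su) _; apply: psi_mono => //; exact: cT.
  by rewrite mulr0; apply: ltW; apply: psi_gt0 => //; exact: ch.2.
rewrite sintZ//; last exact: bmeas_indic.
rewrite sint_indic//; last by move=> u [].
have [_] := feasible_polar2 ff; rewrite -/c0.
have c00 : 0 <= c0.
  rewrite -(mul0r (fine (mu S))) -sint_cst; apply: sint_le => //.
  - exact: bmeas_cst.
  - exact: (bmeas_psi cpos1).
  by move=> u Su; apply: ltW; exact: psi_gt0.
have : c0 + 1 <= (c0 + 1) / a * fine (mu (cap x de)).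
  rewrite mulrAC -mulrA ler_peMr ?ler_pdivlMr ?mul1r//; last exact: ha.
  by lra.
lra.
Qed.

(** The previous bound gives the Lipschitz constant. For the lower bound, a small support function
    at [v] makes the gauge large on the cap around [v]: its logarithm is at least
    [ln de - ln (polar (polar f) v)] there and at least [- ln b] elsewhere. Entropy at most 0 then
    bounds [ln (polar (polar f) v)] from below, which gives [r]. *)
Lemma polar2_class : exists r L, [/\ 0 < r, 0 < L &
  forall f, feasible f -> entropy f <= 0 ->
    lipschitz_class r L (polar (polar f))].
Proof.
have [b b1 hb] := polar2_upper; have b0 : 0 < b by lra.
have [a [de [a0 de0 ha]]] := not_concentrated_cap lamfin n0 lamnc.
set m := fine (lam S); have m0 : 0 <= m by exact: fine_ge0.
have lb0 : 0 <= ln b by rewrite ln_ge0.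
pose K0 := ln b * m / a; have K00 : 0 <= K0 by rewrite divr_ge0 ?mulr_ge0// ltW.
pose r := expR (ln de + ln b - K0); pose L := n%:R * b.
exists r, L; split; first exact: expR_gt0.
  by rewrite mulr_gt0// ltr0n.
move=> f ff Ef; have [cf _] := ff.
have cg := polar_cpos n0 cf; have ch := polar_cpos n0 cg.
have Lip x y : `|polar (polar f) x - polar (polar f) y| <= L * `|x - y|.
  have -> : L = n%:R / b^-1 by rewrite invrK.
  by apply: polar_lip => //; [rewrite invr_gt0|move=> u Su; exact: hb].
split => // [x|v Sv].
  by have := Lip x 0; rewrite polar0// !subr0.
have hv0 := ch.2 v Sv.
rewrite -[leRHS]lnK// ler_expR.
pose K := ln de - ln (polar (polar f) v) + ln b.
have mc : measurable (cap v de) by exact: measurable_cap.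
have : sint lam (fun u => - ln b + K * \1_(cap v de) u) <= entropy f.
  apply: sint_le => //.
  - apply: bmeasD; first exact: bmeas_cst.
    by apply: bmeasZ; exact: bmeas_indic.
  - exact: bmeas_entropy.
  move=> u Su; rewrite indicE; case: (boolP (u \in _)) => [/set_mem [_ cu]|_].
    rewrite mulr1 /K [leLHS](_ : _ = ln de - ln (polar (polar f) v)); last by ring.
    rewrite lerBlDr -lnM ?posrE//; last exact: cg.2.
    rewrite ler_ln ?posrE//; last by rewrite mulr_gt0// cg.2.
    apply: le_trans (ltW cu) _; rewrite mulrC; exact: polar_ge.
  rewrite mulr0 addr0 -lnV// ler_ln ?posrE ?invr_gt0//; first exact: hb.
  exact: cg.2.
rewrite sintD//; last 2 first.
- exact: bmeas_cst.
- by apply: bmeasZ; exact: bmeas_indic.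
rewrite sintZ ?sint_cst//; last exact: bmeas_indic.
rewrite sint_indic// -/m; last by move=> u [].
move=> h; suff : K <= K0 by rewrite /K; lra.
case: (leP K 0) => [?|K1]; first exact: le_trans K00.
rewrite /K0 ler_pdivlMr//.
have := ler_wpM2l (ltW K1) (ha v Sv); lra.
Qed.

Lemma entropy_minimizer : exists2 f, feasible f &
  forall f', feasible f' -> entropy f <= entropy f'.
Proof.
have [r [L [r0 L0 HH]]] := polar2_class.
set H := lipschitz_class (n := n) r L.
pose J (h : {ptws V -> R}) := sint mu (fun u : V => Psi u (h u)).
have cJ : {within H, continuous J}.
  apply: lipschitz_class_continuous => // h eps Hh e0.
  set m := fine (mu S); have m0 : 0 <= m by exact: fine_ge0.
  have e1 : 0 < eps / (m + 1) by rewrite divr_gt0// ltr_wpDl.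
  have [d d0 hd] := dom_unif_cont (psi_cont GI) L r0 e1.
  exists d => // h' Hh' hh'.
  apply: (@le_lt_trans _ _ (eps / (m + 1) * m)).
    apply: sint_dist => //.
    - by apply: bmeas_psi; exact: lipschitz_class_cpos Hh.
    - by apply: bmeas_psi; exact: lipschitz_class_cpos Hh'.
    move=> u Su; apply: ltW; apply: hd => //.
    - exact: lipschitz_class_itv Hh Su.
    - exact: lipschitz_class_itv Hh' Su.
    by rewrite distrC; exact: hh'.
  by rewrite mulrAC ltr_pdivrMr ?ltr_wpDl// ltr_pM2l// ltrDl.
have cE : {within H, continuous (entropy : {ptws V -> R} -> R)}.
  apply: lipschitz_class_continuous => // h eps Hh e0.
  set m := fine (lam S); have m0 : 0 <= m by exact: fine_ge0.
  have ch := lipschitz_class_cpos r0 Hh.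
  exists (eps / (m + 1) * r) => [|h' Hh' hh'].
    by rewrite mulr_gt0// divr_gt0// ltr_wpDl.
  have ch' := lipschitz_class_cpos r0 Hh'.
  set t := eps / (m + 1); have t0 : 0 < t by rewrite divr_gt0// ltr_wpDl.
  apply: (@le_lt_trans _ _ (t * m)).
    (* Since [g] is at least [r], an additive error below [t * r] is a factor at most [1 + t]; the
       polar reverses the inequality and the logarithm turns the factor into the summand [t]. *)
    have key f g : cpos f -> cpos g -> (forall u, S u -> r <= g u) ->
        (forall u, S u -> `|f u - g u| < t * r) -> forall x, S x ->
        ln (polar g x) <= t + ln (polar f x).
      move=> cf cg rg fg x Sx.
      have pf := polar_gt0 n0 cf Sx; have pg := polar_gt0 n0 cg Sx.
      apply: (@le_trans _ _ (ln (1 + t) + ln (polar f x))); last first.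
        by rewrite lerD2r; apply: le_ln1Dx; lra.
      have t1 : 0 < 1 + t by lra.
      rewrite -lnM ?posrE// ler_ln ?posrE ?mulr_gt0//.
      apply: polar_mono => // u Su.
      have := fg u Su; rewrite ltr_norml => /andP[_ h1].
      have := ler_wpM2l (ltW t0) (rg u Su); lra.
    apply: sint_dist => //; try exact: bmeas_entropy.
    move=> x Sx.
    have k1 := key h' h ch' ch (fun u Su => (andP (lipschitz_class_itv L0 Hh Su)).1) hh' x Sx.
    have hh u : S u -> `|h u - h' u| < t * r by move=> /hh'; rewrite distrC.
    have k2 := key h h' ch ch' (fun u Su => (andP (lipschitz_class_itv L0 Hh' Su)).1) hh x Sx.
    by rewrite ler_norml; apply/andP; split; lra.
  by rewrite /t mulrAC ltr_pdivrMr ?ltr_wpDl// ltr_pM2l// ltrDl.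
have cH : compact (H `&` [set h | J h <= sint mu (fun u : V => Psi u 1)]).
  by apply: compact_sublevel => //; exact: compact_lipschitz_class.
have inH f : feasible f -> entropy f <= 0 ->
    (H `&` [set h | J h <= sint mu (fun u : V => Psi u 1)]) (polar (polar f)).
  by move=> ff Ef; split; [exact: HH|exact: (feasible_polar2 ff).2].
have E1 : entropy (fun=> 1) <= 0 by rewrite entropy1.
have [||f /set_mem [Hf Jf] hf] := @compact_EVT_min _ R
  (entropy : {ptws V -> R} -> R) _ _ cH.
- by exists (polar (polar (fun=> 1))); apply: inH => //; exact: feasible1.
- by apply: continuous_subspaceW cE => h [].
exists f; first by split=> //; exact: lipschitz_class_cpos Hf.
have key f' : feasible f' -> entropy f' <= 0 -> entropy f <= entropy f'.
  move=> ff' E'; rewrite -(entropy_polar2 ff'.1); apply: hf; apply/mem_set; exact: inH.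
(* The class contains only double polars of competitors with entropy at most 0; any other one loses
   to the constant 1, whose entropy is 0. *)
move=> f' ff'; case: (leP (entropy f') 0) => [|E']; first exact: key.
by apply: le_trans (ltW E'); rewrite -entropy1; exact: key feasible1 E1.
Qed.

End Minimizer.

(** * Normals of a dual pair *)

Section DualPair.
Variables (R : realType) (n : nat) (n0 : (0 < n)%N).
Local Notation V := 'rV[R]_n.
Local Notation BV := (borelV R n).
Local Notation S := (@sphere R n).
Variables (h g : V -> R).
Hypotheses (ch : cpos h) (cg : cpos g).
Hypotheses (hg : forall x, polar h x = g x) (gh : forall u, polar g u = h u).

Definition normal (x u : V) := S u /\ dotp x u = g x * h u.

Lemma gauge_continuous : continuous g.
Proof. by rewrite (_ : g = polar h); [exact: polar_continuous|exact/funext]. Qed.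

Lemma support_continuous : continuous h.
Proof. by rewrite (_ : h = polar g); [exact: polar_continuous|exact/funext]. Qed.

Lemma gauge_ge x u : S u -> dotp x u <= g x * h u.
Proof. by move=> Su; rewrite -hg; exact: polar_ge. Qed.

Lemma normal_exists x : exists u, normal x u.
Proof. by have [u Su E] := polar_att x n0 ch; exists u; split=> //; rewrite -hg. Qed.

(** Projecting along a compact factor keeps sets closed. All Borel measurability of sets defined by
    the existence of certain normals comes from here. *)
Lemma closed_projection (T : topologicalType) (K : set T) (C : set (V * T)) :
  compact K -> closed C -> closed [set x | S x /\ exists2 w, K w & C (x, w)].
Proof.
move=> cK cC; apply: compact_closed; first exact: norm_hausdorff.
rewrite (_ : mkset _ = fst @` ((S `*` K) `&` C)).
  apply: continuous_compact; last first.
    by apply: compact_closedI => //; apply: compact_setX => //; exact: compact_sphere.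
  by apply: continuous_subspaceT => -[x w]; exact: cvg_fst.
apply/seteqP; split => [x [Sx [w Kw Cw]]|_ [[x w] [[/= Sx Kw] Cw] <-]].
  by exists (x, w).
by split => //; exists w.
Qed.

Lemma closed_eq_fun (T : topologicalType) (f1 f2 : T -> R) :
  continuous f1 -> continuous f2 -> closed [set x | f1 x = f2 x].
Proof.
move=> c1 c2; rewrite (_ : mkset _ = (fun x => f1 x - f2 x) @^-1` [set 0]).
  apply: closed_comp; last exact: closed_eq.
  by move=> x _; exact: (cvgB (c1 x) (c2 x)).
apply/seteqP; split => x /=; first by move=> ->; rewrite subrr.
by move/eqP; rewrite subr_eq0 => /eqP.
Qed.

Lemma closed_le_fun (T : topologicalType) (f1 f2 : T -> R) :
  continuous f1 -> continuous f2 -> closed [set x | f1 x <= f2 x].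
Proof.
move=> c1 c2; rewrite (_ : mkset _ = (fun x => f2 x - f1 x) @^-1` [set y | 0 <= y]).
  apply: closed_comp; last exact: closed_ge.
  by move=> x _; exact: (cvgB (c2 x) (c1 x)).
by apply/seteqP; split => x /=; rewrite subr_ge0.
Qed.

Lemma closed_normal (T : topologicalType) (p1 p2 : T -> V) :
  continuous p1 -> continuous p2 -> closed [set p | normal (p1 p) (p2 p)].
Proof.
move=> c1 c2; rewrite (_ : mkset _ = (p2 @^-1` S) `&`
   [set p | dotp (p1 p) (p2 p) = g (p1 p) * h (p2 p)]); last by [].
apply: closedI; first by apply: closed_comp => [x _|]; [exact: c2|exact: closed_sphere].
apply: closed_eq_fun => x; first exact: (cvg_dotp (c1 x) (c2 x)).
apply: (@cvgM _ _ (nbhs x)).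
  exact: (cvg_comp _ _ (c1 x) (@gauge_continuous (p1 x))).
exact: (cvg_comp _ _ (c2 x) (@support_continuous (p2 x))).
Qed.

(* u / h u and v / h v are subgradients of the convex function g at x; if they
   differ, then so do their i-th coordinates for some i. *)
Definition split_normals (i : 'I_n) (m : nat) : set V := [set x | S x /\
  exists2 w : V * V, (S `*` S) w &
    [/\ normal x w.1, normal x w.2 &
      m.+1%:R^-1 * (h w.1 * h w.2) <= w.1 ord0 i * h w.2 - w.2 ord0 i * h w.1]].

Lemma closed_split_normals i m : closed (split_normals i m).
Proof.
apply: (@closed_projection _ (S `*` S) [set p : V * (V * V) |
    [/\ normal p.1 p.2.1, normal p.1 p.2.2 &
      m.+1%:R^-1 * (h p.2.1 * h p.2.2) <= p.2.1 ord0 i * h p.2.2 - p.2.2 ord0 i * h p.2.1]]).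
  by apply: compact_setX; exact: compact_sphere.
have c1 : continuous (fun p : V * (V * V) => p.1) by move=> p; exact: cvg_fst.
have c21 : continuous (fun p : V * (V * V) => p.2.1).
  by move=> p; apply: (@cvg_comp _ _ _ snd fst (nbhs p) (nbhs p.2) (nbhs p.2.1)); [exact: cvg_snd|exact: cvg_fst].
have c22 : continuous (fun p : V * (V * V) => p.2.2).
  by move=> p; apply: (@cvg_comp _ _ _ snd snd (nbhs p) (nbhs p.2) (nbhs p.2.2)); [exact: cvg_snd|exact: cvg_snd].
have ch1 (p : V * (V * V)) : h q.2.1 @[q --> p] --> h p.2.1.
  exact: (cvg_comp _ _ (c21 p) (@support_continuous _)).
have ch2 (p : V * (V * V)) : h q.2.2 @[q --> p] --> h p.2.2.
  exact: (cvg_comp _ _ (c22 p) (@support_continuous _)).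
have ci1 (p : V * (V * V)) : (fun q : V * (V * V) => q.2.1 ord0 i) @ p --> p.2.1 ord0 i.
  exact: (@cvg_comp _ _ _ (fun q : V * (V * V) => q.2.1) (fun z : V => z ord0 i)
    (nbhs p) (nbhs p.2.1) (nbhs (p.2.1 ord0 i)) (c21 p) (@coord_continuous R 1 n ord0 i p.2.1)).
have ci2 (p : V * (V * V)) : (fun q : V * (V * V) => q.2.2 ord0 i) @ p --> p.2.2 ord0 i.
  exact: (@cvg_comp _ _ _ (fun q : V * (V * V) => q.2.2) (fun z : V => z ord0 i)
    (nbhs p) (nbhs p.2.2) (nbhs (p.2.2 ord0 i)) (c22 p) (@coord_continuous R 1 n ord0 i p.2.2)).
rewrite (_ : mkset _ = [set p | normal p.1 p.2.1] `&` [set p | normal p.1 p.2.2] `&`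
  [set p : V * (V * V) | m.+1%:R^-1 * (h p.2.1 * h p.2.2) <=
     p.2.1 ord0 i * h p.2.2 - p.2.2 ord0 i * h p.2.1]); last first.
  by apply/seteqP; split => p; [case|case=> -[]].
apply: closedI; first by apply: closedI; exact: closed_normal.
apply: closed_le_fun => p.
  apply: (@cvgM _ _ (nbhs p) _ (fun=> m.+1%:R^-1)); first exact: (@cvg_cst _ _ _ (nbhs p)).
  exact: (cvgM (ch1 p) (ch2 p)).
exact: (cvgB (cvgM (ci1 p) (ch2 p)) (cvgM (ci2 p) (ch1 p))).
Qed.

(** Testing [u] at [x + r e_i] and [v] at [x - r e_i] bounds the second difference of [g] below by
    [r * (u_i / h u - v_i / h v)], which is at least [r / (m + 1)]. Normals are constant along rays,
    so the same jump occurs on the whole cone. *)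
Lemma sph_null_split_normals i m : sph_null (split_normals i m).
Proof.
have [a a0 ha] := cpos_min n0 ch.
apply: (@leb_null_convex_jump _ _ g (n%:R / a) m.+1%:R^-1 i).
- by rewrite divr_ge0// ltW.
- by move=> x y; rewrite -!hg; exact: polar_lip.
- move=> x r; rewrite -!hg subr_ge0.
  have := polarD (x + r *: delta_mx ord0 i) (x - r *: delta_mx ord0 i) n0 ch.
  by rewrite addrACA subrr addr0 -mulr2n -scaler_nat polarZ.
- by rewrite invr_gt0.
- move=> _ [t [x [/andP[t0 t1] [[_ Sx] ->]]]].
  rewrite normrZ ger0_norm ?(ltW t0)//.
  by rewrite mulr_ile1// ?(ltW t0)// sphere_norm_le.
move=> _ r [t [x [/andP[t0 t1] [[[Sx [[u v] _ [/= [Su nu] [Sv nv] sp]]] _] ->]]]] r0.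
set e := delta_mx ord0 i.
have hu := ch.2 u Su; have hv := ch.2 v Sv.
have := gauge_ge (t *: x + r *: e) Su; have := gauge_ge (t *: x - r *: e) Sv.
rewrite dotpBl dotpDl !dotpZl nu nv !dotp_delta.
have -> : g (t *: x) = t * g x by rewrite -!hg polarZ// ltW.
move=> h1 h2; rewrite -(ler_pM2r hu) -(ler_pM2r hv).
have k1 := ler_wpM2r (ltW hu) h1; have k2 := ler_wpM2r (ltW hv) h2.
have k3 := ler_wpM2l (ltW r0) sp.
set A := g (t *: x + _) in h2 k2 *; set B := g (t *: x - _) in h1 k1 *.
have -> : (A + B - 2 * (t * g x)) * h u * h v =
  A * h u * h v + B * h v * h u - 2 * (t * g x * h u * h v) by ring.
have E1 : (t * (g x * h u) + r * u ord0 i) * h v = t * g x * h u * h v + r * (u ord0 i * h v) by ring.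
have E2 : (t * (g x * h v) - r * v ord0 i) * h u = t * g x * h u * h v - r * (v ord0 i * h u) by ring.
rewrite E1 in k2; rewrite E2 in k1.
have -> : m.+1%:R^-1 * r * h u * h v = r * (m.+1%:R^-1 * (h u * h v)) by ring.
apply: le_trans k3 _; rewrite mulrBr; lra.
Qed.

(** A countable union of closed sets, hence Borel; it contains every unit vector with two different
    normals. *)
Definition irregular : set V := \bigcup_k
  (if (unpickle k : option ('I_n * nat)) is Some (i, m) then split_normals i m else set0).

Lemma measurable_irregular : measurable (irregular : set BV).
Proof.
apply: bigcupT_measurable => k; case: unpickle => [[i m]|]; last exact: measurable0.
by apply: closed_borelV; exact: closed_split_normals.
Qed.

Lemma irregular_null (lam : {measure set BV -> \bar R}) : in_M lam -> lam irregular = 0%E.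
Proof.
move=> [_ nlam]; apply: (measure_negligible measurable_irregular).
apply: negligible_bigcup => k; case: unpickle => [[i m]|]; last exact: negligible_set0.
have mN : measurable (split_normals i m : set BV) by apply: closed_borelV; exact: closed_split_normals.
by exists (split_normals i m); split => //; apply: nlam => //; exact: sph_null_split_normals.
Qed.

Lemma normal_unique x u v : S x -> ~ irregular x -> normal x u -> normal x v -> u = v.
Proof.
move=> Sx nx nu nv; have [Su Eu] := nu; have [Sv Ev] := nv.
have hu := ch.2 u Su; have hv := ch.2 v Sv.
have key i (u' v' : V) : normal x u' -> normal x v' ->
    u' ord0 i * h v' <= v' ord0 i * h u'.
  move=> nu' nv'; rewrite leNgt; apply/negP => lt.
  have hu' := ch.2 u' nu'.1; have hv' := ch.2 v' nv'.1.
  (* The difference of the [i]-th coordinates of the two subgradients; any [m] with [1 / (m + 1)] at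
     most [D] puts [x] into the irregular set. *)
  pose D := (u' ord0 i * h v' - v' ord0 i * h u') / (h u' * h v').
  have D0 : 0 < D by rewrite divr_gt0 ?subr_gt0// mulr_gt0.
  apply: nx; exists (pickle (i, Num.truncn D^-1)) => //; rewrite pickleK.
  split => //; exists (u', v'); first by split; [exact: nu'.1|exact: nv'.1].
  split => //=; rewrite -ler_pdivlMr ?mulr_gt0// -/D.
  by rewrite -[leRHS]invrK lef_pV2 ?posrE ?invr_gt0// ltW// truncnS_gt.
(* The subgradients [u / h u] and [v / h v] agree; comparing lengths of the unit vectors gives
   [h u = h v]. *)
have E : h v *: u = h u *: v.
  apply/rowP => i; rewrite !mxE mulrC (mulrC (h u)).
  by apply/eqP; rewrite eq_le !key.
have : dotp (h v *: u) (h v *: u) = dotp (h u *: v) (h u *: v) by rewrite E.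
rewrite !dotpZl !dotpZr Su Sv !mulr1 -!expr2 => /eqP.
rewrite eqrXn2 ?ltW// => /eqP hE; move: E; rewrite hE.
by move=> /(scalerI (lt0r_neq0 hu)).
Qed.

(** The default is one fixed unit vector: values stay on the sphere everywhere, and arbitrary
    choices of normals at irregular points cannot spoil measurability. *)
Definition gauss (x : V) : V :=
  if (x \in S) && (x \notin irregular) then xget 0 (normal x)
  else delta_mx ord0 (Ordinal n0).

Lemma gauss_normal x : S x -> ~ irregular x -> normal x (gauss x).
Proof.
move=> Sx ix; rewrite /gauss mem_set// (introT negP) => [|/set_mem]//=.
by have [u nu] := normal_exists x; exact: (xgetI 0 nu).
Qed.

Lemma gauss_sphere x : S (gauss x).
Proof.
rewrite /gauss; case: ifPn => [_|_]; last exact: delta_sphere.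
have [u nu] := normal_exists x.
by case: (xgetI 0 nu : normal x (xget 0 (normal x))).
Qed.

Lemma closed_normal_image (C : set V) : closed C ->
  closed [set x | S x /\ exists2 u, S u & (normal x u /\ C u)].
Proof.
move=> cC; apply: (@closed_projection _ S [set p | normal p.1 p.2 /\ C p.2]).
  exact: compact_sphere.
rewrite (_ : mkset _ = [set p | normal p.1 p.2] `&` snd @^-1` C); last by [].
apply: closedI.
  by apply: closed_normal => p; [exact: cvg_fst|exact: cvg_snd].
by apply: closed_comp => // p _; exact: cvg_snd.
Qed.

(** At a regular point the image lies in a closed [C] iff some normal does, and the points with a
    normal in [C] form a closed set. The remaining points contribute a Borel set or nothing,
    according to the default value. *)
Lemma measurable_gauss : measurable_fun setT (gauss : BV -> BV).
Proof.
have mG : measurable (S `\` irregular : set BV).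
  by apply: measurableD; [exact: measurable_sphere|exact: measurable_irregular].
have E : @measurable _ BV = <<s @open V >> by [].
apply: (measurability _ E) => //.
move=> _ [U oU <-]; rewrite setTI -[X in measurable X]setCK; apply: measurableC.
rewrite preimage_setC; set C := ~` U; have cC : closed C by exact: open_closedC.
pose N : set V := [set x | S x /\ exists2 u, S u & (normal x u /\ C u)].
have mN : measurable (N : set BV) by apply: closed_borelV; exact: closed_normal_image.
have mE : measurable ([set x : V | ~ (S `\` irregular) x /\ C (delta_mx ord0 (Ordinal n0))] : set BV).
  have [Cd|nCd] := pselect (C (delta_mx ord0 (Ordinal n0))).
    rewrite (_ : mkset _ = ~` (S `\` irregular)); first exact: measurableC.
    by apply/seteqP; split => x //= [].
  by rewrite (_ : mkset _ = set0); [exact: measurable0|rewrite -subset0 => x []].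
rewrite (_ : gauss @^-1` C = ((S `\` irregular) `&` N) `|`
   [set x : V | ~ (S `\` irregular) x /\ C (delta_mx ord0 (Ordinal n0))]).
  by apply: measurableU => //; exact: measurableI.
apply/seteqP; split => x /=.
  have [[Sx ix]|nx] := pselect ((S `\` irregular) x) => Cx.
    left; split => //; split => //; exists (gauss x); first exact: gauss_sphere.
    by split => //; exact: gauss_normal.
  right; split => //; move: Cx; rewrite /gauss; case: ifPn => // /andP[/set_mem Sx /negP ix].
  by exfalso; apply: nx; split => // /mem_set.
move=> [[[Sx ix] [_ [u _ [nu Cu]]]]|[nx Cd]].
  by rewrite (normal_unique Sx ix (gauss_normal Sx ix) nu).
rewrite /gauss; case: ifPn => // /andP[/set_mem Sx /negP ix].
by exfalso; apply: nx; split => // /mem_set.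
Qed.

End DualPair.

(** * First variation *)

Section Variation.
Variables (R : realType) (n : nat) (n0 : (0 < n)%N).
Local Notation V := 'rV[R]_n.
Local Notation BV := (borelV R n).
Local Notation S := (@sphere R n).
Variables (h g : V -> R).
Hypotheses (ch : cpos h) (cg : cpos g).
Hypotheses (hg : forall x, polar h x = g x) (gh : forall u, polar g u = h u).
Local Notation normal := (normal h g).
Local Notation irregular := (irregular h g).
Local Notation gauss := (gauss n0 h g).

Variables (phi : V -> R) (M : R).
Hypotheses (cphi : csph phi) (M0 : 0 < M) (phiM : forall u, S u -> `|phi u| <= M).

(** With this form the polar is the maximum of [dotp x u / h u * (1 + t * phi u)], a maximum of
    functions affine in [t]. *)
Definition perturb (t : R) (u : V) := h u / (1 + t * phi u).
(** The relative difference quotient of the gauge; its limit at 0 is a logarithmic derivative. *)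
Definition quotient (t : R) (x : V) := (polar (perturb t) x / g x - 1) / t.

Lemma perturb_den t u : 0 <= t -> t * M <= 1 / 2 -> S u ->
  [/\ - (t * M) <= t * phi u, t * phi u <= t * M & 0 < 1 + t * phi u].
Proof.
move=> t0 tM Su; have := phiM Su; rewrite ler_norml => /andP[p1 p2].
have k1 := ler_wpM2l t0 p1; have k2 := ler_wpM2l t0 p2.
by split; rewrite -?mulrN//; lra.
Qed.

Lemma perturb_cpos t : 0 <= t -> t * M <= 1 / 2 -> cpos (perturb t).
Proof.
move=> t0 tM.
have cd : cpos (fun u => 1 + t * phi u).
  split=> [|u Su]; last by case: (perturb_den t0 tM Su).
  by apply: csphD; [exact: csph_cst|apply: csphM => //; exact: csph_cst].
split=> [|u Su]; last by rewrite divr_gt0// ?ch.2// cd.2.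
by apply: csphM; [exact: ch.1|exact: csphV].
Qed.

Lemma quotient_ge t x u : 0 < t -> t * M <= 1 / 2 -> S x -> normal x u ->
  phi u <= quotient t x.
Proof.
move=> t0 tM Sx [Su nu]; have gx := cg.2 _ Sx; have hu := ch.2 _ Su.
have cp := perturb_cpos (ltW t0) tM.
have [_ _ d0] := perturb_den (ltW t0) tM Su.
have := polar_ge x n0 cp Su; rewrite nu /perturb mulrA ler_pdivlMr// => k.
rewrite /quotient ler_pdivlMr// lerBrDl ler_pdivlMr//.
have {}k : (g x * (1 + t * phi u)) * h u <= polar (perturb t) x * h u.
  by move: k; rewrite mulrAC.
by move: k; rewrite ler_pM2r//; apply: le_trans; rewrite mulrC (mulrC t).
Qed.

(** A maximizer [u] for the perturbed gauge is merely a competitor for [g]. The equality is recorded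
    because it later shows that [u] is nearly a normal at [x]. *)
Lemma quotient_le t x : 0 < t -> t * M <= 1 / 2 -> S x ->
  exists u, [/\ S u, quotient t x <= phi u &
    polar (perturb t) x * h u = dotp x u * (1 + t * phi u)].
Proof.
move=> t0 tM Sx; have gx := cg.2 _ Sx.
have cp := perturb_cpos (ltW t0) tM.
have [u Su E] := polar_att x n0 cp; exists u.
have [_ _ d0] := perturb_den (ltW t0) tM Su; have hu := ch.2 _ Su.
have {}E : polar (perturb t) x * h u = dotp x u * (1 + t * phi u).
  by rewrite E /perturb -!mulrA mulVf ?mulr1// gt_eqF.
split => //; rewrite /quotient ler_pdivrMr// lerBlDl ler_pdivrMr//.
rewrite -(ler_pM2r hu) E mulrAC (mulrC _ t).
by rewrite [leRHS](_ : _ = g x * h u * (1 + t * phi u)) ?ler_pM2r//; [exact: gauge_ge|ring].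
Qed.

Lemma quotient_bound t x : 0 < t -> t * M <= 1 / 2 -> S x -> `|quotient t x| <= M.
Proof.
move=> t0 tM Sx; have [u [Su q1 _]] := quotient_le t0 tM Sx.
have [v nv] := normal_exists n0 ch hg x.
have q2 := quotient_ge t0 tM Sx nv.
have := phiM Su; have := phiM nv.1; rewrite !ler_norml => /andP[? ?] /andP[? ?].
by apply/andP; split; lra.
Qed.

(* Near-maximizers of (x . u) / h u are close to the unique normal at x. *)
Lemma quotient_cvg (x : V) (eps : R) : S x -> ~ irregular x -> 0 < eps ->
  exists2 t0, 0 < t0 & forall t, 0 < t -> t < t0 -> t * M <= 1 / 2 ->
    `|quotient t x - phi (gauss x)| < eps.
Proof.
move=> Sx ix e0; have nx := gauss_normal n0 ch hg Sx ix.
have gx := cg.2 _ Sx.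
(* A dichotomy uniform in [u]: either [phi u] is close to its value at the normal, or [u] misses the
   maximum by the fixed amount [d]. *)
have [|d d0 hd] := @compact_uniform_radius R _ _
   (fun d (u : V) => `|phi u - phi (gauss x)| < eps \/ dotp x u + d <= g x * h u)
   (@compact_sphere R n).
  move=> u Su; have [nu|nu] := pselect (normal x u).
    have <- : u = gauss x := normal_unique ch Sx ix nu nx.
    have [d d0 hd] := csph_eps cphi Su e0.
    exists (ball u d); first exact: nbhsx_ballx.
    exists 1 => // v d'; rewrite -ball_normE /= => uv Sv _ _; left.
    by rewrite distrC; exact: hd.
  have gap : 0 < g x * h u - dotp x u.
    rewrite subr_gt0 lt_neqAle (gauge_ge n0 ch hg)// andbT; apply/negP => /eqP E.
    exact: nu.
  have cG : csph (fun u => g x * h u - dotp x u).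
    apply: csphD; last by apply: csphN; exact: csph_dotp.
    by apply: csphM; [exact: csph_cst|exact: ch.1].
  set G := g x * h u - dotp x u in gap.
  have [d d0 hd] := csph_eps cG Su (divr_gt0 gap (ltr0Sn R 1)).
  exists (ball u d); first exact: nbhsx_ballx.
  exists (G / 2); first by rewrite divr_gt0.
  move=> v d'; rewrite -ball_normE /= => uv Sv _ d'G; right.
  by have := hd v Sv uv; rewrite -/G ltr_norml => /andP[_ ?]; lra.
have [b b0 hb] := csph_bound n0 ch.1.
have D0 : 0 < 4 * (M * (g x * b)) by rewrite !mulr_gt0.
exists (d / (4 * (M * (g x * b)))); first by rewrite divr_gt0.
move=> t t0; rewrite ltr_pdivlMr// => td tM.
have q1 := quotient_ge t0 tM Sx nx.
have [u [Su q2 E]] := quotient_le t0 tM Sx.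
have [near|far] := hd u Su.
  by move: near; rewrite !ltr_norml => /andP[? ?]; apply/andP; split; lra.
(* A maximizer in the second case would satisfy [W * (1 + Q) <= (W - d) * (1 + P)], that is
   [d * (1 + P) <= W * (P - Q)]. The left side is at least [d / 2], and the choice of [t] puts the
   right side below [d / 2]. *)
exfalso; have hu := ch.2 _ Su.
have [p1 p2 p0] := perturb_den (ltW t0) tM Su.
have [r1 r2 r0] := perturb_den (ltW t0) tM nx.1.
have hub : h u <= b by have := hb u Su; rewrite gtr0_norm.
have lowq : g x * (1 + t * phi (gauss x)) <= polar (perturb t) x.
  move: q1; rewrite /quotient ler_pdivlMr// lerBrDl ler_pdivlMr//.
  by rewrite mulrC (mulrC (phi _)).
set P := t * phi u in p1 p2 p0 E; set Q := t * phi (gauss x) in r1 r2 r0 lowq.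
set W := g x * h u in far.
have W0 : 0 < W by rewrite mulr_gt0.
have Wb : W <= g x * b by rewrite ler_pM2l.
have k1 : W * (1 + Q) <= (W - d) * (1 + P).
  apply: (@le_trans _ _ (polar (perturb t) x * h u)).
    by rewrite /W mulrAC ler_pM2r.
  by rewrite E ler_pM2r//; lra.
have k2 : d * (1 / 2) <= d * (1 + P) by rewrite ler_pM2l//; lra.
have k3 : W * (P - Q) <= W * (2 * (t * M)) by rewrite ler_pM2l//; lra.
have k4 : W * (t * M) <= g x * b * (t * M) by rewrite ler_pM2r// mulr_gt0.
have k5 : t * (4 * (M * (g x * b))) = 4 * (g x * b * (t * M)) by ring.
have k6 : W * (1 + Q) = W * (1 + P) - W * (P - Q) by ring.
have k7 : (W - d) * (1 + P) = W * (1 + P) - d * (1 + P) by ring.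
lra.
Qed.

Variables (lam mu : {measure set BV -> \bar R}).
Hypotheses (lamM : in_M lam) (mufin : (mu setT < +oo)%E).
Variable Psi : V -> R -> R.
Hypothesis GI : G_I Psi.
Hypothesis hfeas : feasible mu Psi h.
Hypothesis hmin : forall f, feasible mu Psi f -> entropy lam h <= entropy lam f.

Let lamfin : (lam setT < +oo)%E. Proof. by case: lamM => -[]. Qed.

Lemma csph_quotient t : 0 < t -> t * M <= 1 / 2 -> csph (quotient t).
Proof.
move=> t0 tM; apply: csphM; last exact: csph_cst.
apply: csphD; last exact: csph_cst.
apply: csphM; last exact: csphV.
apply: continuous_csph; apply: polar_continuous => //; exact: perturb_cpos (ltW t0) tM.
Qed.

Lemma perturb_feasible :
  0 < sint mu (fun u => Psi_t Psi u (h u) * (h u * phi u)) ->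
  exists2 t0, 0 < t0 & forall t, 0 < t -> t < t0 -> feasible mu Psi (perturb t).
Proof.
set I := sint mu _ => I0.
have [a a0 ha] := cpos_min n0 ch.
have [b b0 hb] := csph_bound n0 ch.1.
have hub u : S u -> h u <= b.
  by move=> Su; have := hb u Su; rewrite gtr0_norm// ch.2.
have a20 : 0 < a / 2 by rewrite divr_gt0.
set m := fine (mu S); have m0 : 0 <= m by exact: fine_ge0.
(* The pointwise error allowed per unit of [t]: integrated against [mu] it is at most the
   first-order gain [I]. *)
pose eps := I / (m + 1); have e0 : 0 < eps by rewrite divr_gt0// ltr_wpDl.
have epsm : eps * m <= I.
  by rewrite /eps mulrAC ler_pdivrMr ?ltr_wpDl// ler_pM2l// lerDl.
clearbody eps.
have [N N0 hN] := dom_bounded (psit_cont GI) (b + a / 2) a20.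
pose e1 := eps / (4 * (b * M)).
have bM0 : 0 < b * M by rewrite mulr_gt0.
have e10 : 0 < e1 by rewrite divr_gt0// mulr_gt0.
have [d d0 hd] := dom_unif_cont (psit_cont GI) (b + a / 2) a20 e10.
(* The four bounds give, in order: denominators at least 1/2; [perturb t u] within [a / 2] of [h u];
   also within [d] of it; and a quadratic error at most [eps / 4]. *)
pose t0 := Num.min (1 / (2 * M)) (Num.min (a / (4 * (b * M))) (Num.min (d / (2 * (b * M)))
  (eps / (4 * (b * M * (M * N)))))).
have c1 : 0 < 1 / (2 * M) by rewrite divr_gt0// mulr_gt0.
have c2 : 0 < a / (4 * (b * M)) by rewrite divr_gt0// mulr_gt0.
have c3 : 0 < d / (2 * (b * M)) by rewrite divr_gt0// mulr_gt0.
have c4' : 0 < 4 * (b * M * (M * N)) by rewrite !mulr_gt0.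
have c4 : 0 < eps / (4 * (b * M * (M * N))) by rewrite divr_gt0.
exists t0; first by rewrite /t0 !lt_min c1 c2 c3 c4.
move=> t tp; rewrite /t0 !lt_min => /and4P[].
rewrite !ltr_pdivlMr ?mulr_gt0// => tt1 tt2 tt3 tt4.
have tM : t * M <= 1 / 2 by lra.
have cp := perturb_cpos (ltW tp) tM; split => //.
have [_ hf] := hfeas; apply: le_trans hf.
have bchi : bmeas (fun u => Psi_t Psi u (h u) * (h u * phi u)).
  apply: csph_bmeas => //; apply: csphM; first by apply: csph_comp_dom => //; exact: psit_cont.
  by apply: csphM => //; exact: ch.1.
suff key u : S u -> Psi u (perturb t u) <=
    Psi u (h u) + (- t * (Psi_t Psi u (h u) * (h u * phi u)) + t * eps).
  apply: (@le_trans _ _ (sint mu (fun u => Psi u (h u) +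
      (- t * (Psi_t Psi u (h u) * (h u * phi u)) + t * eps)))).
    apply: sint_le => //; first exact: bmeas_psi.
    apply: bmeasD; first exact: bmeas_psi.
    by apply: bmeasD; [exact: bmeasZ|exact: bmeas_cst].
  rewrite sintD//; last 2 first.
  - exact: bmeas_psi.
  - by apply: bmeasD; [exact: bmeasZ|exact: bmeas_cst].
  rewrite sintD//; last 2 first.
  - exact: bmeasZ.
  - exact: bmeas_cst.
  rewrite sintZ// sint_cst -/I -/m.
  have := ler_wpM2l (ltW tp) epsm; lra.
move=> Su; have hu := ch.2 u Su; have h1 := ha u Su; have h2 := hub u Su.
have [p1 p2 p0] := perturb_den (ltW tp) tM Su.
set P := t * phi u in p1 p2 p0.
have fu : perturb t u - h u = - (P * h u / (1 + P)).
  by rewrite /perturb -/P; field; rewrite gt_eqF.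
have fb : `|perturb t u - h u| <= 2 * (t * (b * M)).
  rewrite fu normrN normrM normfV (gtr0_norm p0) ler_pdivrMr//.
  rewrite normrM (gtr0_norm hu).
  have Pb : `|P| <= t * M by rewrite ler_norml p1.
  apply: (@le_trans _ _ ((t * M) * b)); first by apply: ler_pM => //; exact: ltW.
  rewrite (_ : 2 * (t * (b * M)) * (1 + P) = t * M * b * (2 * (1 + P))); last by ring.
  by rewrite ler_peMr ?mulr_ge0 ?(ltW tp) ?(ltW M0) ?(ltW b0)//; lra.
have fp : 0 < perturb t u by exact: cp.2.
have [c cd E] := psi_MVT_dist GI Su hu fp.
have cd2 : `|c - h u| <= a / 2 by apply: le_trans cd _; apply: le_trans fb _; lra.
have cd3 : `|h u - c| < d by rewrite distrC; apply: le_lt_trans cd _; apply: le_lt_trans fb _; lra.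
have ci : a / 2 <= c <= b + a / 2.
  by move: cd2; rewrite ler_norml => /andP[? ?]; apply/andP; split; lra.
have hi : a / 2 <= h u <= b + a / 2 by apply/andP; split; lra.
have k1 := hd u (h u) c Su hi ci cd3.
have k2 := hN u (h u) Su hi.
rewrite -subr_le0 opprD addrA E fu.
set A := Psi_t Psi u (h u) in k1 k2 *; set B := Psi_t Psi u c in k1 *.
(* Exact remainder: [A - B] is the variation of [Psi_t] up to the intermediate point, and [A * P]
   the second-order part of [h / (1 + P)]. Each contributes at most [eps / 4], leaving a factor 2
   for the division by [1 + P]. *)
have -> : B * - (P * h u / (1 + P)) - (- t * (A * (h u * phi u)) + t * eps) =
  t * ((h u * phi u) * ((A - B) + A * P) / (1 + P) - eps).
  by rewrite /P; field; rewrite gt_eqF.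
rewrite pmulr_rle0//.
rewrite subr_le0 ler_pdivrMr//.
apply: le_trans (ler_norm _) _; rewrite normrM.
have n1 : `|h u * phi u| <= b * M.
  by rewrite normrM; apply: ler_pM => //; [exact: hb|exact: phiM].
have n2 : `|A - B + A * P| <= e1 + N * (t * M).
  apply: le_trans (ler_normD _ _) _; apply: lerD; first exact: ltW.
  by rewrite normrM; apply: ler_pM => //; rewrite ler_norml p1.
apply: (@le_trans _ _ (b * M * (e1 + N * (t * M)))); first exact: ler_pM.
have e1E : b * M * e1 = eps / 4 by rewrite /e1; field; rewrite !gt_eqF.
have -> : b * M * (e1 + N * (t * M)) = b * M * e1 + t * (b * M * (M * N)) by ring.
have k3 := ler_wpM2l (ltW e0) p1.
have k4 := ler_wpM2l (ltW e0) tM.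
rewrite e1E; lra.
Qed.

(** By [ln (1 + s) <= s] the change of entropy is at most [t] times the integral of the quotient, so
    minimality passes to the quotients without a limit of logarithms. *)
Lemma quotient_sint_ge0 t : 0 < t -> t * M <= 1 / 2 -> feasible mu Psi (perturb t) ->
  0 <= sint lam (quotient t).
Proof.
move=> t0 tM ft; have cp := perturb_cpos (ltW t0) tM.
have := hmin ft; rewrite -subr_ge0 /entropy => E0.
have bh := bmeas_entropy n0 ch; have bp := bmeas_entropy n0 cp.
have : sint lam (fun x : V => ln (polar (perturb t) x) + -1 * ln (polar h x)) <=
    sint lam (fun x => t * quotient t x).
  apply: sint_le => //.
  - by apply: bmeasD => //; exact: bmeasZ.
  - by apply: bmeasZ; apply: csph_bmeas => //; exact: csph_quotient.
  move=> x Sx; rewrite mulN1r hg /quotient.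
  have gx := cg.2 _ Sx; have px := polar_gt0 n0 cp Sx.
  rewrite mulrCA mulfV ?gt_eqF// mulr1 -lnV ?posrE// -lnM ?posrE ?invr_gt0//.
  rewrite -[X in ln X](subrKC 1); apply: le_ln1Dx.
  by rewrite ltrBrDl subrr divr_gt0.
rewrite sintD//; last exact: bmeasZ.
rewrite !sintZ//; last by apply: csph_bmeas => //; exact: csph_quotient.
rewrite mulN1r => k; have := le_trans E0 k.
by rewrite pmulr_rge0.
Qed.

Lemma bmeas_gauss psi : bmeas psi -> bmeas (fun x => psi (gauss x)).
Proof.
move=> [mpsi [b hb]]; split; last by exists b => x _; apply: hb; exact: gauss_sphere.
move=> _ Y mY; rewrite (_ : _ `&` _ = S `&` (gauss @^-1` (S `&` psi @^-1` Y))).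
  apply: measurableI; first exact: measurable_sphere.
  rewrite -[X in measurable X]setTI; apply: measurable_gauss => //.
  by apply: mpsi => //; exact: measurable_sphere.
apply/seteqP; split => x [Sx /= Yx]; split => //.
  by split => //; exact: gauss_sphere.
by case: Yx.
Qed.

(** The strict sign makes small perturbations feasible; the conclusion is the limit of the previous
    inequality by dominated convergence, with the constant bound [M]. *)
Lemma first_variation :
  0 < sint mu (fun u => Psi_t Psi u (h u) * (h u * phi u)) ->
  0 <= sint lam (fun x => phi (gauss x)).
Proof.
move=> /perturb_feasible[t0 t00 ht0].
pose s := Num.min t0 (1 / (2 * M)).
have s0 : 0 < s by rewrite /s lt_min t00 divr_gt0// mulr_gt0.
(* The shift by 2 makes every term, including the first, strictly smaller than [s]. *)
pose tt (k : nat) := s / k.+2%:R.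
have tt0 k : 0 < tt k by rewrite divr_gt0.
have tts k : tt k < s by rewrite ltr_pdivrMr// ltr_pMr// ltr1n.
have ttM k : tt k * M <= 1 / 2.
  have : tt k < 1 / (2 * M) by apply: lt_le_trans (tts k) _; rewrite ge_min lexx orbT.
  by rewrite ltr_pdivlMr ?mulr_gt0// => ?; lra.
have ttt k : tt k < t0 by apply: lt_le_trans (tts k) _; rewrite ge_min lexx.
have tte e : 0 < e -> exists k0, forall k, (k0 <= k)%N -> tt k < e.
  move=> e0; exists (Num.truncn (s / e)) => k kk.
  rewrite /tt ltr_pdivrMr// mulrC -ltr_pdivrMr//.
  by apply: lt_le_trans (truncnS_gt _) _; rewrite ler_nat ltnS ltnW.
have mS := @measurable_sphere R n.
have bq k : bmeas (quotient (tt k)) by apply: csph_bmeas => //; exact: csph_quotient.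
have bphi := bmeas_gauss (csph_bmeas n0 cphi).
have ae : {ae lam, forall x, S x ->
    (fun k => (quotient (tt k) x)%:E) @ \oo --> (phi (gauss x))%:E}.
  exists irregular; split.
  - exact: (measurable_irregular n0 ch cg hg gh).
  - exact: (irregular_null n0 ch cg hg gh lamM).
  move=> x /= nx; apply: contrapT => ix; apply: nx => Sx.
  apply: cvg_EFin; first exact: nearW.
  apply/cvgrPdist_lt => e e0.
  have [t1 t10 ht1] := quotient_cvg Sx ix e0; have [k0 hk0] := tte _ t10.
  exists k0 => // k /= kk; rewrite distrC; apply: ht1 => //; exact: hk0.
have ae2 : {ae lam, forall x k, S x -> (`|(quotient (tt k) x)%:E| <= (cst M%:E) x)%E}.
  by apply: aeW => x k Sx /=; rewrite lee_fin; exact: quotient_bound.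
have m1 k : measurable_fun (S : set BV) (fun x : BV => (quotient (tt k) x)%:E).
  by apply/measurable_EFinP; exact: (bq k).1.
have m2 : measurable_fun (S : set BV) (fun x : BV => (phi (gauss x))%:E).
  by apply/measurable_EFinP; exact: bphi.1.
have [_ _ cvgI] := @dominated_convergence _ BV R lam S mS
  (fun k x => (quotient (tt k) x)%:E) (fun x => (phi (gauss x))%:E) (cst M%:E)
  m1 m2 ae 
  (bmeas_integrable lamfin (bmeas_cst n M)) ae2.
rewrite -lee_fin -sintE//.
rewrite -(cvg_lim (@ereal_hausdorff R) cvgI); apply: lime_ge.
  by apply/cvg_ex; eexists; exact: cvgI.
apply: nearW => k /=; rewrite sintE// lee_fin; apply: quotient_sint_ge0 => //.
exact: ht0.
Qed.

End Variation.

(** * From test functions to Borel sets *)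

Section BoundedConvergence.
Variables (R : realType) (n : nat) (n0 : (0 < n)%N).
Local Notation V := 'rV[R]_n.
Local Notation BV := (borelV R n).
Local Notation S := (@sphere R n).
Variable mu : {measure set BV -> \bar R}.
Hypothesis mufin : (mu setT < +oo)%E.

Lemma bmeasM (f g : V -> R) : bmeas f -> bmeas g -> bmeas (fun u => f u * g u).
Proof.
move=> [mf [M hM]] [mg [N hN]]; split; first exact: measurable_funM.
by exists (M * N) => u Su; rewrite normrM; apply: ler_pM => //; [exact: hM|exact: hN].
Qed.

Lemma sint_bounded_cvg (f_ : nat -> V -> R) (f : V -> R) (M : R) :
  (forall k, bmeas (f_ k)) -> bmeas f ->
  (forall k u, S u -> `|f_ k u| <= M) ->
  (forall u, S u -> exists k0, forall k, (k0 <= k)%N -> f_ k u = f u) ->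
  sint mu (f_ k) @[k --> \oo] --> sint mu f.
Proof.
move=> bf_ bf fM ff.
have mS := @measurable_sphere R n.
have m1 k : measurable_fun (S : set BV) (fun x : BV => (f_ k x)%:E).
  by apply/measurable_EFinP; exact: (bf_ k).1.
have m2 : measurable_fun (S : set BV) (fun x : BV => (f x)%:E).
  by apply/measurable_EFinP; exact: bf.1.
have ae1 : {ae mu, forall x, S x -> (fun k => (f_ k x)%:E) @ \oo --> (f x)%:E}.
  apply: aeW => x Sx; apply: cvg_EFin; first exact: nearW.
  have [k0 hk0] := ff x Sx.
  apply/cvgrPdist_lt => e e0; exists k0 => // k /= kk.
  by rewrite hk0// subrr normr0.
have ae2 : {ae mu, forall x k, S x -> (`|(f_ k x)%:E| <= (cst M%:E) x)%E}.
  by apply: aeW => x k Sx /=; rewrite lee_fin; exact: fM.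
have [_ _ cvgI] := @dominated_convergence _ BV R mu S mS
  (fun k x => (f_ k x)%:E) (fun x => (f x)%:E) (cst M%:E)
  m1 m2 ae1 (bmeas_integrable mufin (bmeas_cst n M)) ae2.
rewrite sintE// in cvgI; exact: (fine_cvg cvgI).
Qed.

End BoundedConvergence.

(** * Continuous approximation of indicators of open sets *)

Section SmoothIndicator.
Variables (R : realType) (n : nat).
Local Notation V := 'rV[R]_n.
Variable O : set V.

(** The element 1 keeps the set nonempty when [O] is the whole space; it truncates the distance to
    the complement. *)
Let gap (x : V) := [set `|x - y| | y in ~` O] `|` [set 1 : R].

Definition gap_dist (x : V) : R := inf (gap x).

Let gap_lb x : lbound (gap x) 0.
Proof. by move=> _ [[y _ <-]|->]. Qed.

Let gap_neq0 x : gap x !=set0. Proof. by exists 1; right. Qed.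

Lemma gap_dist_ge0 x : 0 <= gap_dist x.
Proof. by apply: lb_le_inf; [exact: gap_neq0|exact: gap_lb]. Qed.

Lemma gap_dist_lip x y : `|gap_dist x - gap_dist y| <= 1 * `|x - y|.
Proof.
have key a b : gap_dist a <= `|a - b| + gap_dist b.
  rewrite -lerBlDl; apply: lb_le_inf; first exact: gap_neq0.
  have hi : has_lbound (gap a) by exists 0; exact: gap_lb.
  move=> _ [[z Oz <-]|->].
    rewrite lerBlDl; apply: le_trans (ler_distD b _ _).
    by apply: (ge_inf hi); left; exists z.
  rewrite lerBlDl; apply: (@le_trans _ _ 1); last by rewrite lerDr.
  by apply: (ge_inf hi); right.
have := key x y; have := key y x; rewrite (distrC y x) mul1r ler_norml => *.
by apply/andP; split; lra.
Qed.

Lemma gap_dist_out x : ~ O x -> gap_dist x = 0.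
Proof.
move=> Ox; apply/eqP; rewrite eq_le gap_dist_ge0 andbT.
have hi : has_lbound (gap x) by exists 0; exact: gap_lb.
by apply: (ge_inf hi); left; exists x => //; rewrite subrr normr0.
Qed.

Lemma gap_dist_in x : open O -> O x -> 0 < gap_dist x.
Proof.
move=> oO Ox; have /nbhs_ballP[e /= e0 he] : nbhs x O by exact: open_nbhs_nbhs.
apply: (@lt_le_trans _ _ (Num.min e 1)); first by rewrite lt_min e0 ltr01.
apply: lb_le_inf; first exact: gap_neq0.
move=> _ [[y Oy <-]|->]; last by rewrite ge_min lexx orbT.
rewrite ge_min leNgt; case: (ltP `|x - y| e) => //= xy.
by exfalso; apply: Oy; apply: he; rewrite -ball_normE.
Qed.

Lemma smooth_indicator : open O -> exists f_ : nat -> V -> R,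
  [/\ forall k, csph (f_ k), forall k u, `|f_ k u| <= 1 &
    forall u, exists k0, forall k, (k0 <= k)%N -> f_ k u = \1_O u].
Proof.
move=> oO; exists (fun k u => Num.min (k%:R * gap_dist u) 1).
have cd : continuous gap_dist by exact: lipschitz_continuous gap_dist_lip.
split=> [k|k u|u].
- apply: continuous_csph => x.
  apply: (@continuous_min _ _ (fun u : V => k%:R * gap_dist u) (fun=> 1)).
    by apply: (@cvgM _ _ (nbhs x) _ (fun=> k%:R)); [exact: (@cvg_cst _ _ _ (nbhs x))|exact: cd].
  exact: (@cvg_cst _ _ _ (nbhs x)).
- rewrite ger0_norm; first by rewrite ge_min lexx orbT.
  by rewrite le_min ler01 mulr_ge0// gap_dist_ge0.
have [Ou|Ou] := pselect (O u); last first.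
  exists 0%N => k _; rewrite gap_dist_out// mulr0 indicE memNset//.
  by rewrite min_l.
have g0 := gap_dist_in oO Ou.
exists (Num.truncn (gap_dist u)^-1).+1 => k kk; rewrite indicE mem_set// min_r//.
rewrite -ler_pdivrMr// mul1r; apply: le_trans (ltW (truncnS_gt _)) _.
by rewrite ler_nat.
Qed.

End SmoothIndicator.

(** * Proportionality of the two measures *)

Section MeasureIdentity.
Variables (R : realType) (n : nat) (n0 : (0 < n)%N).
Local Notation V := 'rV[R]_n.
Local Notation BV := (borelV R n).
Local Notation S := (@sphere R n).
Variables (h g : V -> R).
Hypotheses (ch : cpos h) (cg : cpos g).
Hypotheses (hg : forall x, polar h x = g x) (gh : forall u, polar g u = h u).
Local Notation gauss := (gauss n0 h g).
Variables (lam mu : {measure set BV -> \bar R}).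
Hypotheses (lamM : in_M lam) (mufin : (mu setT < +oo)%E) (muS : 0 < fine (mu S)).
Variable Psi : V -> R -> R.
Hypothesis GI : G_I Psi.
Hypothesis hfeas : feasible mu Psi h.
Hypothesis hmin : forall f, feasible mu Psi f -> entropy lam h <= entropy lam f.

Definition weight (u : V) : R := (h u * Psi_t Psi u (h u))^-1.

(** The integral of [psi] against $\widetilde J_{\Psi,\lambda}(K,\cdot)$ for the Wulff shape [K] of
    [h], pulled back by the Gauss map. *)
Definition gauss_int (psi : V -> R) := sint lam (fun x => weight (gauss x) * psi (gauss x)).

Let lamfin : (lam setT < +oo)%E. Proof. by case: lamM => -[]. Qed.

Lemma weight_cpos : cpos weight.
Proof.
have cd : cpos (fun u => h u * Psi_t Psi u (h u)).
  split=> [|u Su].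
    by apply: csphM; [exact: ch.1|apply: csph_comp_dom => //; exact: psit_cont].
  by rewrite mulr_gt0 ?ch.2// psit_gt0// ch.2.
by split; [exact: csphV|move=> u Su; rewrite invr_gt0; exact: cd.2].
Qed.

Let bw : bmeas weight. Proof. by apply: csph_bmeas => //; case: weight_cpos. Qed.

Lemma bmeas_gauss_weight psi : bmeas psi ->
  bmeas (fun x => weight (gauss x) * psi (gauss x)).
Proof.
move=> bpsi.
exact: (@bmeas_gauss _ _ n0 _ _ ch cg hg gh (fun u => weight u * psi u) (bmeasM bw bpsi)).
Qed.

(** The first variation with [phi] equal to [weight] times [psi]: the weight cancels the factor
    [Psi_t * h] on the side of [mu]. *)
Lemma gauss_int_ge0 psi : csph psi -> 0 < sint mu psi -> 0 <= gauss_int psi.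
Proof.
move=> cpsi p0; have cphi : csph (fun u => weight u * psi u).
  by apply: csphM => //; case: weight_cpos.
have [M M0 hM] := csph_bound n0 cphi.
have := @first_variation _ _ n0 _ _ ch cg hg gh _ _ cphi M0 hM _ _ lamM mufin _ GI hfeas hmin.
apply.
rewrite (@sint_eq _ _ _ _ psi)// => u Su.
have hu := ch.2 u Su; have pu := psit_gt0 GI Su hu.
by rewrite /weight; field; rewrite !gt_eqF.
Qed.

Lemma gauss_intD f1 f2 : bmeas f1 -> bmeas f2 ->
  gauss_int (fun u => f1 u + f2 u) = gauss_int f1 + gauss_int f2.
Proof.
move=> b1 b2; rewrite /gauss_int -sintD//; try exact: bmeas_gauss_weight.
by apply: sint_eq => u _; rewrite mulrDr.
Qed.

Lemma gauss_intZ f1 c : bmeas f1 -> gauss_int (fun u => c * f1 u) = c * gauss_int f1.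
Proof.
move=> b1; rewrite /gauss_int -sintZ//; last exact: bmeas_gauss_weight.
by apply: sint_eq => u _; rewrite mulrCA.
Qed.

Let Lam1 := gauss_int (fun=> 1).

(** A linear functional that is nonnegative wherever another one is positive is a multiple of it;
    the constant function 1 identifies the factor. *)
Lemma gauss_int_csph psi : csph psi ->
  gauss_int psi * fine (mu S) = sint mu psi * Lam1.
Proof.
set m := fine (mu S).
have L0 : 0 <= Lam1 by apply: gauss_int_ge0; [exact: csph_cst|rewrite sint_cst// mul1r].
have half f : csph f -> sint mu f * Lam1 <= gauss_int f * m.
  move=> cf; have bf := csph_bmeas n0 cf.
  apply/ler_addgt0Pr => e e0.
  (* Subtracting the mean makes the [mu]-integral 0; the extra constant makes it strictly positive,
     at a final cost of at most [e]. *)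
  pose c := - (sint mu f / m) + e / (Lam1 * m + 1).
  have Lm0 : 0 <= Lam1 * m by rewrite mulr_ge0// ltW.
  have d0 : 0 < e / (Lam1 * m + 1) by rewrite divr_gt0// ltr_wpDl.
  have : 0 <= gauss_int (fun u => f u + c * 1).
    apply: gauss_int_ge0; first by apply: csphD => //; exact: csph_cst.
    rewrite sintD//; last by apply: bmeasZ; exact: bmeas_cst.
    rewrite sint_cst -/m mulr1 /c mulrDl mulNr divfK ?gt_eqF//.
    by rewrite addrA subrr add0r mulr_gt0.
  rewrite gauss_intD//; last by apply: bmeasZ; exact: bmeas_cst.
  rewrite gauss_intZ; last exact: bmeas_cst.
  rewrite -/Lam1 => k; have {k} := mulr_ge0 k (ltW muS).
  rewrite -/m mulrDl /c.
  have -> : (- (sint mu f / m) + e / (Lam1 * m + 1)) * Lam1 * m =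
     - (sint mu f * Lam1) + e * (Lam1 * m / (Lam1 * m + 1)).
    by field; rewrite !gt_eqF// ltr_wpDl.
  have k2 : e * (Lam1 * m / (Lam1 * m + 1)) <= e.
    by rewrite ler_piMr ?ltW// ltr_pdivrMr ?ltr_wpDl// mul1r ltrDl.
  lra.
move=> cpsi; have bpsi := csph_bmeas n0 cpsi.
apply/eqP; rewrite eq_le half// andbT.
have := half (fun u => -1 * psi u) (csphM (@csph_cst R n (-1)) cpsi).
rewrite gauss_intZ// sintZ// !mulN1r !mulNr; lra.
Qed.

Lemma gauss_int_cvg (f_ : nat -> V -> R) (f : V -> R) (M : R) :
  (forall k, bmeas (f_ k)) -> bmeas f ->
  (forall k u, S u -> `|f_ k u| <= M) ->
  (forall u, S u -> exists k0, forall k, (k0 <= k)%N -> f_ k u = f u) ->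
  (forall k, gauss_int (f_ k) * fine (mu S) = sint mu (f_ k) * Lam1) ->
  gauss_int f * fine (mu S) = sint mu f * Lam1.
Proof.
move=> bf_ bf fM ff E; have [b b0 hb] := csph_bound n0 weight_cpos.1.
have c1 : gauss_int (f_ k) @[k --> \oo] --> gauss_int f.
  apply: (@sint_bounded_cvg _ _ _ lamfin _ _ (b * M)).
  - by move=> k; exact: bmeas_gauss_weight.
  - exact: bmeas_gauss_weight.
  - move=> k u Su; rewrite normrM; have Sg := gauss_sphere n0 ch hg u.
    by apply: ler_pM => //; [exact: hb|exact: fM].
  - move=> u Su; have [k0 hk0] := ff _ (gauss_sphere n0 ch hg u).
    by exists k0 => k /hk0 ->.
have c2 := sint_bounded_cvg mufin bf_ bf fM ff.
have c1' : gauss_int (f_ k) * fine (mu S) @[k --> \oo] --> gauss_int f * fine (mu S).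
  exact: (cvgM c1 (cvg_cst _)).
have c2' : sint mu (f_ k) * Lam1 @[k --> \oo] --> sint mu f * Lam1.
  exact: (cvgM c2 (cvg_cst _)).
rewrite (_ : (fun k => gauss_int (f_ k) * _) = (fun k => sint mu (f_ k) * Lam1)) in c1'.
  exact: (cvg_unique _ c1' c2').
by apply/funext => k; exact: E.
Qed.

(** Dynkin's theorem: open sets form a pi-system, and the identity survives proper differences and
    increasing unions. *)
Lemma gauss_int_indic (A : set BV) : measurable A ->
  gauss_int (\1_A) * fine (mu S) = sint mu (\1_A) * Lam1.
Proof.
move=> mA.
pose H := [set B : set V | measurable (B : set BV) /\
  gauss_int (\1_B) * fine (mu S) = sint mu (\1_B) * Lam1].
suff : <<s @open V >> `<=` H by move=> /(_ A mA) [].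
have I1 B u : `|(\1_B u : R)| <= 1.
  by rewrite indicE; case: (u \in B); rewrite ?normr1 ?normr0.
apply: lambda_system_subset => //.
- by move=> B C oB oC; exact: openI.
- split => //.
  + split; first exact: measurableT.
    by rewrite indicT; apply: gauss_int_csph; exact: csph_cst.
  + move=> B C CB [mB EB] [mC EC]; split; first exact: measurableD.
    have -> : \1_(B `\` C) = (fun u => \1_B u + -1 * \1_C u) :> (V -> R).
      apply/funext => u; rewrite !indicE in_setD.
      have [Cu|Cu] := pselect (C u); last by rewrite (memNset Cu) andbT /= mulr0 addr0.
      by rewrite !(mem_set Cu) (mem_set (CB _ Cu)) /= mulr1 subrr.
    have b1 := bmeas_indic mB; have b2 := bmeas_indic mC.
    have b3 := bmeasZ (-1) b2.
    rewrite gauss_intD// gauss_intZ// sintD// sintZ//.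
    by rewrite !mulN1r !mulrBl EB EC.
  + move=> F ndF HF; have mF k : measurable (F k : set BV) by case: (HF k).
    have mU : measurable (\bigcup_k F k : set BV) by exact: bigcupT_measurable.
    split => //; apply: (@gauss_int_cvg (fun k => \1_(F k)) _ 1) => //.
    * by move=> k; exact: bmeas_indic.
    * exact: bmeas_indic.
    * move=> u _; have [[k0 _ Fu]|nF] := pselect ((\bigcup_k F k) u).
        exists k0 => k kk; rewrite !indicE (mem_set (_ : (\bigcup_k F k) u)); last by exists k0.
        by rewrite mem_set//; have /subsetPset := ndF _ _ kk; apply.
      exists 0%N => k _; rewrite !indicE (memNset nF) memNset// => Fu.
      by apply: nF; exists k.
    * by move=> k; case: (HF k).
move=> U oU; split; first exact: open_borelV.
have [f_ [cf f1 ff]] := smooth_indicator oU.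
apply: (@gauss_int_cvg f_ _ 1) => //.
- by move=> k; exact: csph_bmeas.
- by apply: bmeas_indic; exact: open_borelV.
- by move=> k; exact: gauss_int_csph.
Qed.

Lemma gauss_int1_gt0 : 0 < fine (lam S) -> 0 < Lam1.
Proof.
move=> l0; have [a a0 ha] := cpos_min n0 weight_cpos.
apply: (@lt_le_trans _ _ (sint lam (fun=> a))); first by rewrite sint_cst mulr_gt0.
apply: sint_le => //; first exact: bmeas_cst.
- exact: (bmeas_gauss_weight (bmeas_cst n 1)).
by move=> u _; rewrite mulr1; apply: ha; exact: (gauss_sphere n0 ch hg).
Qed.

End MeasureIdentity.

(** * Convex bodies *)

Section Bodies.
Variables (R : realType) (n : nat) (n0 : (0 < n)%N).
Local Notation V := 'rV[R]_n.
Local Notation BV := (borelV R n).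
Local Notation S := (@sphere R n).

Definition wulff (h : V -> R) : set V := [set x | forall u, S u -> dotp u x <= h u].

(** In general the support function of a Wulff shape is only at most [h]. If [h] is its own double
    polar at [u], equality is attained at the boundary point [x / polar h x], with [x] optimal in
    [polar (polar h) u]. *)
Lemma wulff_supp_fun h u : cpos h -> polar (polar h) u = h u -> S u ->
  supp_fun (wulff h) u = h u.
Proof.
move=> ch gh Su; have cg := polar_cpos n0 ch.
have [x Sx E] := polar_att u n0 cg; rewrite gh in E.
have gx := cg.2 _ Sx.
have Kx : wulff h ((polar h x)^-1 *: x).
  move=> v Sv; rewrite dotpZr ler_pdivrMl//; rewrite dotpC; exact: polar_ge.
have ub : ubound [set dotp u y | y in wulff h] (h u) by move=> _ [y Ky <-]; exact: Ky.
apply/eqP; rewrite eq_le; apply/andP; split.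
  by apply: ge_sup => //; exists (dotp u ((polar h x)^-1 *: x)), ((polar h x)^-1 *: x).
apply: ub_le_sup; first by exists (h u).
exists ((polar h x)^-1 *: x) => //; rewrite dotpZr E; field; exact: lt0r_neq0.
Qed.

Lemma wulff_radial_fun h x : cpos h -> S x -> radial_fun (wulff h) x = (polar h x)^-1.
Proof.
move=> ch Sx; have gx := polar_gt0 n0 ch Sx.
have ub : ubound [set t | 0 <= t /\ wulff h (t *: x)] (polar h x)^-1.
  move=> t [t0 Kt]; have [u Su E] := polar_att x n0 ch; have hu := ch.2 u Su.
  have := Kt u Su; rewrite dotpZr dotpC E mulrA ger_pMl// => k.
  by rewrite -[leRHS]mul1r ler_pdivlMr.
have mem : [set t | 0 <= t /\ wulff h (t *: x)] (polar h x)^-1.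
  split; first by rewrite invr_ge0 ltW.
  by move=> v Sv; rewrite dotpZr ler_pdivrMl// dotpC; exact: polar_ge.
apply/eqP; rewrite eq_le; apply/andP; split.
  by apply: ge_sup => //; exists (polar h x)^-1.
by apply: ub_le_sup => //; exists (polar h x)^-1.
Qed.

Lemma wulff_normals h x : cpos h -> (forall u, S u -> supp_fun (wulff h) u = h u) ->
  S x -> normals (wulff h) x = normal h (polar h) x.
Proof.
move=> ch hK Sx; have gx := polar_gt0 n0 ch Sx.
apply/seteqP; split => u [Su].
  by rewrite wulff_radial_fun// dotpZr hK// => E; split => //; rewrite dotpC -E; field; exact: lt0r_neq0.
by move=> E; split => //; rewrite wulff_radial_fun// dotpZr hK// dotpC E; field; exact: lt0r_neq0.
Qed.

Lemma wulff_convex_body h : cpos h -> convex_body_o (wulff h).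
Proof.
move=> ch; have [a a0 ha] := cpos_min n0 ch; have [b b0 hb] := csph_bound n0 ch.1.
split; last split.
- apply: bounded_closed_compact.
    exists b; split; first exact: num_real.
    move=> B bB x Kx; apply: norm_le_coord => [|i]; first by rewrite ltW// (lt_trans b0).
    have Sd := @delta_sphere R n i.
    have := Kx _ Sd; have := Kx _ (sphere_opp Sd); rewrite dotpNl dotp_delta.
    have := hb _ Sd; have := hb _ (sphere_opp Sd); rewrite !ler_norml => /andP[_ ?] /andP[_ ?] ? ?.
    by apply/andP; split; lra.
  rewrite (_ : wulff h = \bigcap_(u in S) [set x | dotp u x <= h u])//.
  apply: closed_bigI => u Su.
  apply: (@closed_comp _ _ (fun x : V => dotp u x) [set y | y <= h u]); last exact: closed_le.
  by move=> x _; rewrite (_ : dotp u = fun x => dotp x u); [exact: continuous_dotp|apply/funext => y; exact: dotpC].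
- move=> x y t Kx Ky /andP[t0 t1] u Su; rewrite dotpDr !dotpZr.
  have := ler_wpM2l t0 (Kx u Su); have t1' : 0 <= 1 - t by lra.
  have := ler_wpM2l t1' (Ky u Su); lra.
apply/nbhs_ballP; exists (a / n%:R); first by rewrite /= divr_gt0// ltr0n.
move=> x; rewrite -ball_normE /= sub0r normrN ltr_pdivlMr ?ltr0n// => xa u Su.
apply: le_trans (ha u Su); rewrite dotpC; apply: le_trans (ler_norm _) _.
by apply: le_trans (sphere_dotp_norm _ Su) _; rewrite mulrC ltW.
Qed.

Section ConvexBody.
Variable K : set V.
Hypothesis Kb : convex_body_o K.

Let Kcompact : compact K. Proof. by case: Kb. Qed.

Lemma body_bounded : exists2 B, 0 < B & forall x, K x -> `|x| <= B.
Proof.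
have [B [_ hB]] := compact_bounded Kcompact.
exists (`|B| + 1); first by rewrite ltr_wpDl.
by move=> x Kx; apply: hB => //; rewrite ltr_pwDr// ler_norm.
Qed.

Lemma body_0 : K 0.
Proof. by case: Kb => _ [_ /interior_subset]. Qed.

Let K0 : K !=set0 := ex_intro _ 0 body_0.

Lemma body_has_sup x : has_sup [set dotp x y | y in K].
Proof.
split; first by exists (dotp x 0), 0 => //; exact: body_0.
have [B B0 hB] := body_bounded; exists (n%:R * `|x| * B) => _ [y Ky <-].
apply: le_trans (ler_norm _) _; apply: le_trans (dotp_le_norm _ _) _.
by rewrite ler_wpM2l ?mulr_ge0// hB.
Qed.

Lemma supp_fun_ge x y : K y -> dotp x y <= supp_fun K x.
Proof. by move=> Ky; apply: ub_le_sup; [case: (body_has_sup x)|exists y]. Qed.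

Lemma supp_fun_cpos : cpos (supp_fun K).
Proof.
split.
  have [B B0 hB] := body_bounded.
  apply: continuous_csph; apply: (@lipschitz_continuous _ _ _ (n%:R * B)) => x y.
  have key a b : supp_fun K a <= supp_fun K b + n%:R * B * `|a - b|.
    apply: ge_sup; first by case: (body_has_sup a).
    move=> _ [z Kz <-]; rewrite -(subrK b a) dotpDl addrC lerD//; first exact: supp_fun_ge.
    apply: le_trans (ler_norm _) _; apply: le_trans (dotp_le_norm _ _) _.
    by rewrite addrK mulrAC ler_wpM2r// ler_wpM2l// hB.
  have := key x y; have := key y x; rewrite (distrC y x) ler_norml => *.
  by apply/andP; split; lra.
move=> u Su; have [_ [_ /nbhs_ballP[e /= e0 he]]] := Kb.
have e20 : 0 < e / 2 by rewrite divr_gt0.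
apply: (@lt_le_trans _ _ (dotp u ((e / 2) *: u))); first by rewrite dotpZr Su mulr1.
apply: supp_fun_ge; apply: he; rewrite -ball_normE /= sub0r normrN normrZ gtr0_norm//.
have := sphere_norm_le Su => u1; apply: (@le_lt_trans _ _ (e / 2)); last by lra.
by rewrite ler_piMr// ltW.
Qed.

(* The unit vector pointing from the nearest point of K towards x separates x
   from K. *)
Lemma body_wulff : K = wulff (supp_fun K).
Proof.
apply/seteqP; split => [y Ky u Su|x Wx]; first exact: supp_fun_ge.
apply: contrapT => nKx.
have cd : {within K, continuous (fun y : V => dotp (x - y) (x - y))}.
  apply: continuous_subspaceT => y.
  have c : (fun z : V => x - z) @ y --> x - y.
    by apply: (@cvgB _ _ _ (nbhs y) _ (fun=> x) id); [exact: (@cvg_cst _ _ _ (nbhs y))|exact: cvg_id].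
  exact: (cvg_dotp c c).
have [p /set_mem Kp hp] := compact_EVT_min K0 Kcompact cd.
have [z Ez] : exists z, z = x - p by exists (x - p).
rewrite -Ez in hp.
have z0 : z != 0 by rewrite Ez; apply/eqP => /subr0_eq E; apply: nKx; rewrite E.
have D0 : 0 < dotp z z.
  rewrite lt_neqAle dotp_ge0 andbT eq_sym; apply: contra z0 => /eqP /dotp_eq0 ->.
  by rewrite eqxx.
have key y : K y -> dotp z (y - p) <= 0.
  move=> Ky; rewrite leNgt; apply/negP => s0.
  have [w Ew] : exists w, w = y - p by exists (y - p).
  rewrite -Ew in s0; set s := dotp z w in s0; set D := dotp w w.
  have ht t : 0 < t -> t <= 1 -> 2 * s <= t * D.
    move=> t0 t1; case: Kb => _ [cK _].
    have Kt : K (t *: y + (1 - t) *: p) by apply: cK => //; rewrite (ltW t0).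
    have := hp _ (mem_set Kt).
    have -> : x - (t *: y + (1 - t) *: p) = z - t *: w.
      by rewrite Ew Ez; apply/rowP => i; rewrite !mxE; ring.
    rewrite dotpBl !dotpBr !dotpZl !dotpZr (dotpC w z) -/s -/D => k.
    rewrite -(ler_pM2l t0); lra.
  (* Moving from [p] towards [y] by the fraction [t] would bring it closer to [x] unless
     [2 * s <= t * D]; this fails at [t = 1] if [D <= s] and at [t = s / D] otherwise. *)
  case: (leP D s) => Ds; first by have := ht 1 ltr01 (lexx _); lra.
  have D'0 : 0 < D by apply: lt_trans Ds.
  have := ht (s / D); rewrite divr_gt0// ler_pdivrMr// mul1r (ltW Ds) divfK ?gt_eqF//.
  by move=> /(_ isT isT); lra.
pose c := Num.sqrt (dotp z z); have c0 : 0 < c by rewrite sqrtr_gt0.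
have cc : c * c = dotp z z by rewrite -expr2 sqr_sqrtr// dotp_ge0.
have Su : S (c^-1 *: z).
  by rewrite /sphere /= dotpZl dotpZr -cc; field; rewrite gt_eqF.
have := Wx _ Su; apply/negP; rewrite -ltNge.
apply: (@le_lt_trans _ _ (dotp (c^-1 *: z) p)).
  apply: ge_sup; first by case: (body_has_sup (c^-1 *: z)).
  move=> _ [y Ky <-]; rewrite -subr_ge0 -dotpBr dotpZl -opprB dotpNr mulrN oppr_ge0.
  by rewrite pmulr_rle0 ?invr_gt0// key.
by rewrite -subr_gt0 -dotpBr -Ez dotpZl mulr_gt0 ?invr_gt0.
Qed.

End ConvexBody.

(** Markov's inequality kills the caps of height [1 / (k + 1)], and they exhaust the open
    hemisphere. *)
Lemma cap_null_of_concentrated (mu : {measure set BV -> \bar R}) : (mu setT < +oo)%E ->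
  (exists2 v, S v & ~ (0 < \int[mu]_(x in (S : set BV)) (Num.max (dotp v x) 0)%:E)%E) ->
  exists2 v, S v & mu (cap v 0) = 0%E.
Proof.
move=> mufin [v Sv nv]; exists v => //.
have bp : bmeas (fun u => Num.max (dotp v u) 0) by apply: csph_bmeas => //; exact: csph_dotp_pos.
rewrite sintE// lte_fin in nv.
have mc k : measurable (cap v k.+1%:R^-1) by exact: measurable_cap.
have c0 k : mu (cap v k.+1%:R^-1) = 0%E.
  have : sint mu (fun u => k.+1%:R^-1 * \1_(cap v k.+1%:R^-1) u) <=
      sint mu (fun u => Num.max (dotp v u) 0).
    apply: sint_le => //; first by apply: bmeasZ; exact: bmeas_indic.
    move=> u Su; rewrite indicE; case: (boolP (u \in _)) => [/set_mem[_ /ltW cu]|_].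
      by rewrite mulr1 le_max cu.
    by rewrite mulr0 le_max lexx orbT.
  rewrite sintZ ?sint_indic//; last by exact: bmeas_indic.
    move=> k1; apply/eqP; rewrite -(fineK (measure_fin mufin (mc k))) eqe.
    rewrite eq_le fine_ge0// andbT leNgt; apply/negP => k2; apply: nv.
    by apply: lt_le_trans k1; rewrite mulr_gt0.
  by move=> u [].
have -> : cap v 0 = \bigcup_k cap v k.+1%:R^-1.
  apply/seteqP; split => u.
    move=> [Su cu]; exists (Num.truncn (dotp v u)^-1) => //; split => //.
    by rewrite -[ltRHS]invrK ltf_pV2 ?posrE ?invr_gt0// truncnS_gt.
  by move=> [k _ [Su cu]]; split => //; apply: lt_trans cu; rewrite invr_gt0.
apply: measure_negligible; first exact: bigcupT_measurable.
by apply: negligible_bigcup => k; exists (cap v k.+1%:R^-1); split.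
Qed.

End Bodies.

(** * Existence and necessity *)

Section Main.
Variables (R : realType) (n : nat) (n0 : (0 < n)%N).
Local Notation V := 'rV[R]_n.
Local Notation BV := (borelV R n).
Local Notation S := (@sphere R n).
Variable Psi : V -> R -> R.
Hypothesis GI : G_I Psi.

Let F (K : set V) xi :=
  (supp_fun K (alpha K xi) * Psi_t Psi (alpha K xi) (supp_fun K (alpha K xi)))^-1.

Lemma wulff_alpha (h : V -> R) x : cpos h ->
  (forall u, S u -> supp_fun (wulff h) u = h u) -> S x ->
  normal h (polar h) x (alpha (wulff h) x).
Proof.
move=> ch hK Sx; rewrite /alpha wulff_normals//.
have [u nu] := @normal_exists _ _ n0 h _ ch (fun=> erefl) x; exact: (xgetI 0 nu).
Qed.

Lemma integrand_weight (h : V -> R) x : cpos h ->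
  (forall u, S u -> supp_fun (wulff h) u = h u) -> S x ->
  F (wulff h) x = weight h Psi (alpha (wulff h) x).
Proof.
move=> ch hK Sx; have [Sa _] := wulff_alpha ch hK Sx.
by rewrite /F hK.
Qed.

Lemma existence (lam mu : {measure set BV -> \bar R}) :
  in_M lam -> not_concentrated lam -> finite_sph_measure mu -> not_concentrated mu ->
  exists K : set V, convex_body_o K /\ normalized_eq mu (Jtilde Psi lam K).
Proof.
move=> lamM lamnc [mufin [mu0 muC]] munc.
have lamfin : (lam setT < +oo)%E by case: lamM => -[].
have fS0 (nu : {measure set BV -> \bar R}) : finite_sph_measure nu -> 0 < fine (nu S).
  move=> [nufin [nu0 nuC]]; have mS := @measurable_sphere R n.
  rewrite fine_gt0// measure_lty// andbT lt0e measure_ge0 andbT.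
  apply/eqP => E; apply: nu0; rewrite -(setUv S) measureU//; last exact: setICr.
    by rewrite -[RHS]adde0; congr (_ + _)%E; [exact: E|exact: nuC].
  exact: measurableC.
have muS : 0 < fine (mu S) by apply: fS0.
have lamS : 0 < fine (lam S) by apply: fS0; case: lamM.
have [f ff fmin] := entropy_minimizer n0 lamfin mufin lamnc munc GI.
have cf := ff.1; pose g := polar f; have cg : cpos g := polar_cpos n0 cf.
(* The minimizer is replaced by its double polar, which is still feasible with the same entropy and
   is the support function of its Wulff shape. *)
pose h := polar g; have ch : cpos h := polar_cpos n0 cg.
have hg x : polar h x = g x by rewrite /h /g polar3.
have gh u : polar g u = h u by [].
have hfeas : feasible mu Psi h by exact: feasible_polar2.
have hmin f' : feasible mu Psi f' -> entropy lam h <= entropy lam f'.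
  by rewrite (entropy_polar2 n0)//; exact: fmin.
have polh : polar h = g by exact/funext.
have hK u : S u -> supp_fun (wulff h) u = h u.
  by move=> Su; apply: wulff_supp_fun => //; rewrite polh.
exists (wulff h); split; first exact: wulff_convex_body.
pose Lam1 := gauss_int n0 h g lam Psi (fun=> 1).
have L0 : 0 < Lam1 by exact: (gauss_int1_gt0 n0 ch cg hg gh lamM GI).
have mI := measurable_irregular n0 ch cg hg gh.
have I0 := irregular_null n0 ch cg hg gh lamM.
have mS := @measurable_sphere R n.
have wc := weight_cpos ch GI.
have Jval (omega : set BV) : measurable omega -> omega `<=` S ->
    Jtilde Psi lam (wulff h) omega = (gauss_int n0 h g lam Psi (\1_omega))%:E.
  move=> mo oS; rewrite /Jtilde.
  have F0 x : alpha_star (wulff h) omega x -> (0 <= (F (wulff h) x)%:E)%E.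
    move=> [Sx _]; rewrite lee_fin integrand_weight// ltW// wc.2//.
    by case: (wulff_alpha ch hK Sx).
  rewrite -[LHS]/(\int[lam]_(x in (alpha_star (wulff h) omega : set BV)) (F (wulff h) x)%:E)%E.
  rewrite (@ge0_lower_integral_setD _ BV R lam _ _ _ F0 mI I0).
  have al x : S x -> ~ irregular h g x -> alpha (wulff h) x = gauss n0 h g x.
    move=> Sx ix; have := wulff_alpha ch hK Sx; rewrite polh => na.
    exact: (normal_unique ch Sx ix na (gauss_normal n0 ch hg Sx ix)).
  have bw : bmeas (fun x => weight h Psi (gauss n0 h g x) * \1_omega (gauss n0 h g x)).
    by apply: (bmeas_gauss_weight n0 ch cg hg gh GI); exact: bmeas_indic.
  rewrite /gauss_int -(sintE lamfin bw) [RHS](@ge0_lower_integral_setD _ BV R lam _ _ _ _ mI I0); last first.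
    move=> x Sx; rewrite lee_fin mulr_ge0// ?indicE// ltW// wc.2//.
    exact: gauss_sphere.
  rewrite [LHS]integral_mkcond [RHS]integral_mkcond; apply: eq_integral => x _.
  rewrite !patchE; case: (boolP (x \in S `\` irregular h g)) => [xS|xS].
    have [Sx ix] := set_mem xS.
    (* At a regular point of the sphere the normal is unique, so membership in [alpha_star] reduces
       to [omega (gauss n0 h g x)] and both integrands agree. *)
    have [og|og] := pselect (omega (gauss n0 h g x)).
      rewrite mem_set; last first.
        split => //; split => //; exists (gauss n0 h g x) => //.
        rewrite wulff_normals// polh; exact: gauss_normal.
      by rewrite integrand_weight// al// indicE mem_set// mulr1.
    rewrite memNset ?indicE ?(memNset og) ?mulr0// => -[[_ [u]]].
    rewrite wulff_normals// polh => nu ou _; apply: og.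
    by rewrite -(normal_unique ch Sx ix nu (gauss_normal n0 ch hg Sx ix)).
  rewrite memNset// => -[[Sx _] ix]; move/negP: xS; apply; exact/mem_set.
have J1 : gauss_int n0 h g lam Psi (\1_S) = Lam1.
  apply: sint_eq => u _; rewrite indicE mem_set//; exact: gauss_sphere.
rewrite /normalized_eq (Jval S)// J1; split; first by rewrite lte_fin.
split; first exact: ltry.
move=> omega mo oS; rewrite Jval//=.
have := gauss_int_indic n0 ch cg hg gh lamM mufin muS GI hfeas hmin mo.
rewrite -/Lam1 sint_indic// => E.
have m1 : fine (mu S) != 0 by rewrite gt_eqF.
have L1 : Lam1 != 0 by rewrite gt_eqF.
by apply/eqP; rewrite eqr_div// E.
Qed.

Lemma necessity (lam mu : {measure set BV -> \bar R}) : finite_sph_measure mu ->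
  pos_on_open lam ->
  (exists K : set V, convex_body_o K /\ normalized_eq mu (Jtilde Psi lam K)) ->
  not_concentrated mu.
Proof.
move=> [mufin _] lampos [K [Kb [J0 [Jfin JE]]]].
apply: contrapT => nc.
have [v Sv cv] : exists2 v, S v & mu (cap v 0) = 0%E.
  apply: cap_null_of_concentrated => //; apply: contrapT => H; apply: nc => u Su.
  by apply: contrapT => k; apply: H; exists u.
have := supp_fun_cpos Kb; set h := supp_fun K => ch.
have KE := body_wulff Kb; rewrite -/h in KE.
have hK u : S u -> supp_fun (wulff h) u = h u by rewrite -KE.
have cg := polar_cpos n0 ch.
have wc := weight_cpos ch GI.
have Fge0 omega x : alpha_star K omega x -> (0 <= (F K x)%:E)%E.
  move=> [Sx _]; rewrite lee_fin KE integrand_weight// ltW// wc.2//.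
  by case: (wulff_alpha ch hK Sx).
have E := JE (cap v 0) (measurable_cap v 0) (fun u => @proj1 _ _).
rewrite cv /= mul0r in E.
have JS : fine (Jtilde Psi lam K S) != 0 by rewrite gt_eqF// fine_gt0// J0.
have Jle : (Jtilde Psi lam K (cap v 0) <= Jtilde Psi lam K S)%E.
  apply: ge0_le_lower_integral; [exact: Fge0|exact: Fge0|move=> x].
  rewrite !patchE; case: ifPn => [/set_mem [Sx [u nu cu]]|_].
    by rewrite mem_set//; split => //; exists u => //; case: cu.
  by case: ifPn => // /set_mem /Fge0.
have J0' : (0 <= Jtilde Psi lam K (cap v 0))%E by apply: integral_ge0; exact: Fge0.
(* [fine] also sends infinity to 0, so finiteness, inherited from the whole sphere, is needed to
   recover the extended value. *)
have {}E : Jtilde Psi lam K (cap v 0) = 0%E.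
  have fin : Jtilde Psi lam K (cap v 0) \is a fin_num.
    by rewrite ge0_fin_numE//; exact: le_lt_trans Jle Jfin.
  move/esym/eqP: E; rewrite mulf_eq0 invr_eq0 (negbTE JS) orbF => /eqP E.
  by rewrite -(fineK fin) E.
have [w0 w00 hw] := cpos_min n0 wc.
have [a a0 ha] := cpos_min n0 ch; have [b b0 hb] := cpos_min n0 cg.
have ab0 : 0 < a * b by rewrite mulr_gt0.
(* A normal [u] at [x] has [dotp x u = g x * h u], at least [a * b]. Replacing [x] by [v] costs at
   most [n] times the distance, so within this radius [dotp v u] stays positive. *)
pose e := a * b / n%:R; have e0 : 0 < e by rewrite divr_gt0// ltr0n.
have near x : ball v e x -> S x -> alpha_star K (cap v 0) x.
  rewrite -ball_normE /= => vx Sx; split => //.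
  have [u nu] := @normal_exists _ _ n0 h _ ch (fun=> erefl) x.
  exists u; first by rewrite KE wulff_normals.
  have [Su xu] := nu; split => //.
  have : a * b <= dotp x u by rewrite xu mulrC ler_pM// ?hb ?ha// ltW.
  have := sphere_dotp_norm (v - x) Su; rewrite dotpBl ler_norml => /andP[k _].
  move: vx; rewrite /e ltr_pdivlMr ?ltr0n// mulrC => vx; lra.
have oB : open (ball v e) by exact: ball_open.
have := lampos _ oB (ex_intro _ v (conj (ballxx v e0) Sv)).
(* The integrand is at least [w0] on the ball, so [w0] times the [lam]-measure of the ball in the
   sphere is at most the vanishing value at the cap. *)
apply/negP; rewrite -leNgt -(@lee_pmul2l _ w0%:E)//.
rewrite mule0 -E.
have mB : measurable (ball v e `&` S : set BV).
  by apply: measurableI; [exact: open_borelV|exact: measurable_sphere].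
rewrite -(integral_cst lam mB); apply: ge0_le_lower_integral.
- by move=> x _; rewrite lee_fin ltW.
- exact: Fge0.
move=> x; rewrite !patchE; case: ifPn => [/set_mem [Bx Sx]|_].
  rewrite mem_set; last exact: near.
  rewrite lee_fin -[leRHS]/(F K x) KE integrand_weight//; apply: hw.
  by case: (wulff_alpha ch hK Sx).
by case: ifPn => // /set_mem /Fge0.
Qed.

End Main.

Theorem theorem5p7 (R : realType) (n : nat) (hn : (2 <= n)%N)
  (lam mu : {measure set (borelV R n) -> \bar R}) (Psi : 'rV[R]_n -> R -> R) :
  in_M lam -> not_concentrated lam -> G_I Psi ->
  finite_sph_measure mu ->
  (not_concentrated mu ->
     exists K : set 'rV[R]_n, convex_body_o K /\ normalized_eq mu (Jtilde Psi lam K))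
  /\
  (pos_on_open lam ->
     (exists K : set 'rV[R]_n, convex_body_o K /\ normalized_eq mu (Jtilde Psi lam K)) ->
     not_concentrated mu).
Proof.
move=> lamM lamnc GI muf; have n0 : (0 < n)%N by exact: leq_trans hn.
split; first exact: existence.
by move=> lampos; exact: necessity.
Qed.
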